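(* Let $n\ge4$ be even. (a) There exists a subgroup of $B_n(\mathbb{S}^2)$ isomorphic to $K_1$. (b) Suppose that either $n\equiv0\bmod4$ or $n\equiv10\bmod{12}$. There exists a subgroup of $B_n(\mathbb{S}^2)$ isomorphic to $K_2$.
   Context: $B_n(\mathbb{S}^2)$ is the $n$-string braid group of the sphere, generated by $\sigma_1,\ldots,\sigma_{n-1}$ subject to $\sigma_i\sigma_j=\sigma_j\sigma_i$ if $|i-j|\ge 2$, $\sigma_i\sigma_{i+1}\sigma_i=\sigma_{i+1}\sigma_i\sigma_{i+1}$ for $1\le i\le n-2$, and $\sigma_1\cdots\sigma_{n-2}\sigma_{n-1}^2\sigma_{n-2}\cdots\sigma_1=1$. The groups $K_1,K_2$ (representatives of the two isomorphism classes of amalgamated products of the form $\mathcal{Q}_{16}\ast_{\mathcal{Q}_8}\mathcal{Q}_{16}$ of generalised quaternion groups of order $16$ along the quaternion group of order $8$) are $$K_1=\langle x,y,a,b\mid x^4=y^2,\ a^4=b^2,\ yxy^{-1}=x^{-1},\ bab^{-1}=a^{-1},\ x^2=a^2,\ y=b\rangle,$$ $$K_2=\langle x,y,a,b\mid x^4=y^2,\ a^4=b^2,\ yxy^{-1}=x^{-1},\ bab^{-1}=a^{-1},\ x^2=b,\ y=a^2b\rangle.$$ *)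

(* Defs.v *)
From HB Require Import structures.
From mathcomp Require Import all_boot.
From mathcomp Require Import boolp.

Set Implicit Arguments.
Unset Strict Implicit.
Unset Printing Implicit Defensive.

Local Open Scope group_scope.
Local Open Scope quotient_scope.

(* Words in the letters t and t^-1 for t : T; the letter (false, t) stands for
   t and (true, t) for its formal inverse.  They form a monoid under
   concatenation, with formal inversion as an involution (no cancellation is
   performed at this stage). *)
Definition word (T : choiceType) : Type := seq (bool * T).

Section Word.
Variable T : choiceType.

HB.instance Definition _ := Choice.on (word T).

Definition letter (t : T) : word T := [:: (false, t)].

Definition word_inv (w : word T) : word T :=
  rev [seq (~~ l.1, l.2) | l <- w].

Fact word_mulA : associative (fun u v : word T => u ++ v : word T).
Proof. exact: catA. Qed.

Fact word_mul1 : left_id ([::] : word T) (fun u v : word T => u ++ v : word T).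
Proof. by []. Qed.

Fact word_invK : involutive word_inv.
Proof.
move=> w; rewrite /word_inv map_rev revK -map_comp -[RHS]map_id.
by apply: eq_map => -[b t] /=; rewrite negbK.
Qed.

Fact word_invM :
  {morph word_inv : u v / (u ++ v : word T) >-> (v ++ u : word T)}.
Proof. by move=> u v; rewrite /word_inv map_cat rev_cat. Qed.

HB.instance Definition _ :=
  isStarMonoid.Build (word T) word_mulA word_mul1 word_invK word_invM.

End Word.

(* The congruence on words generated by the relations R u v, read as u = v,
   together with w * w^-1 = 1 for all w. *)
Inductive pres_eq (T : choiceType) (R : word T -> word T -> Prop) :
    word T -> word T -> Prop :=
  | PresRel u v of R u v : pres_eq R u v
  | PresV w : pres_eq R (w * w^-1) 1
  | PresRefl w : pres_eq R w w
  | PresSym u v of pres_eq R u v : pres_eq R v u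
  | PresTrans u v w of pres_eq R u v & pres_eq R v w : pres_eq R u w
  | PresMul u u' v v' of pres_eq R u u' & pres_eq R v v' :
      pres_eq R (u * v) (u' * v').

(* The group < T | R > with set of generators T and relations u = v whenever
   R u v holds. *)
Section Presented.
Variables (T : choiceType) (R : word T -> word T -> Prop).

Definition pres_rel : rel (word T) := fun u v => `[< pres_eq R u v >].

Fact pres_rel_refl : reflexive pres_rel.
Proof. by move=> w; apply/asboolP; apply: PresRefl. Qed.

Fact pres_rel_sym : symmetric pres_rel.
Proof. by move=> u v; apply/asboolP/asboolP; apply: PresSym. Qed.

Fact pres_rel_trans : transitive pres_rel.
Proof. by move=> v u w /asboolP uv /asboolP vw; apply/asboolP/(PresTrans uv). Qed.

Canonical pres_equiv :=
  EquivRel pres_rel pres_rel_refl pres_rel_sym pres_rel_trans.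

Definition presented : Type := {eq_quot pres_equiv}.

HB.instance Definition _ := Choice.on presented.
HB.instance Definition _ := EqQuotient.on presented.

Lemma presentedP (u v : word T) : u = v %[mod presented] <-> pres_eq R u v.
Proof. by split => [/eqmodP/asboolP|uv] //; apply/eqmodP/asboolP. Qed.

Definition pres_mul (x y : presented) : presented := \pi_presented (repr x * repr y).
Definition pres_one : presented := \pi_presented 1.
Definition pres_inv (x : presented) : presented := \pi_presented (repr x)^-1.

Fact pres_eq_repr (w : word T) : pres_eq R (repr (\pi_presented w)) w.
Proof. by apply/presentedP; rewrite reprK. Qed.

Fact pres_mulA : associative pres_mul.
Proof.
move=> x y z; apply/presentedP.
apply: PresTrans (PresMul (PresRefl _ _) (pres_eq_repr _)) _.
rewrite mulgA; apply: PresSym.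
exact: PresMul (pres_eq_repr _) (PresRefl _ _).
Qed.

Fact pres_mul1 : left_id pres_one pres_mul.
Proof.
move=> x; rewrite -[RHS]reprK; apply/presentedP.
rewrite -[X in pres_eq R _ X]mul1g.
exact: PresMul (pres_eq_repr _) (PresRefl _ _).
Qed.

Fact pres_mulr1 : right_id pres_one pres_mul.
Proof.
move=> x; rewrite -[RHS]reprK; apply/presentedP.
rewrite -[X in pres_eq R _ X]mulg1.
exact: PresMul (PresRefl _ _) (pres_eq_repr _).
Qed.

Fact pres_mulV : left_inverse pres_one pres_inv pres_mul.
Proof.
move=> x; apply/presentedP.
apply: PresTrans (PresMul (pres_eq_repr _) (PresRefl _ _)) _.
by rewrite -[X in _ * X]invgK; apply: PresV.
Qed.

Fact pres_mulVr : right_inverse pres_one pres_inv pres_mul.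
Proof.
move=> x; apply/presentedP.
apply: PresTrans (PresMul (PresRefl _ _) (pres_eq_repr _)) _.
exact: PresV.
Qed.

HB.instance Definition _ :=
  isGroup.Build presented pres_mulA pres_mul1 pres_mulr1 pres_mulV pres_mulVr.

End Presented.

Definition isomorphic (G H : groupType) : Prop :=
  exists f : {multiplicative G -> H}, bijective f.

(* The index i : 'I_n.-1 is 0-based: letter i is the generator sigma_(i+1).
   The two successive products in the last relation put the square of
   sigma_(n-1) in the middle. *)
Inductive sphere_braid_rel (n : nat) : word 'I_n.-1 -> word 'I_n.-1 -> Prop :=
  | BraidFar (i j : 'I_n.-1) of (i.+2 <= j)%N || (j.+2 <= i)%N :
      sphere_braid_rel (letter i * letter j) (letter j * letter i)
  | BraidNear (i j : 'I_n.-1) of j = i.+1 :> nat :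
      sphere_braid_rel (letter i * letter j * letter i)
                       (letter j * letter i * letter j)
  | BraidSphere :
      sphere_braid_rel
        ((\prod_(i < n.-1) letter i) * \prod_(i < n.-1) letter (rev_ord i)) 1.

Definition sphere_braid (n : nat) : groupType :=
  presented (@sphere_braid_rel n).

Inductive Kgen : Type := Kx | Ky | Ka | Kb.

HB.instance Definition _ := gen_eqMixin Kgen.
HB.instance Definition _ := gen_choiceMixin Kgen.

Local Notation x := (letter Kx).
Local Notation y := (letter Ky).
Local Notation a := (letter Ka).
Local Notation b := (letter Kb).

Inductive K1_rel : word Kgen -> word Kgen -> Prop :=
  | K1_x4 : K1_rel (x ^+ 4) (y ^+ 2)
  | K1_a4 : K1_rel (a ^+ 4) (b ^+ 2)
  | K1_yx : K1_rel (y * x * y^-1) x^-1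
  | K1_ba : K1_rel (b * a * b^-1) a^-1
  | K1_x2 : K1_rel (x ^+ 2) (a ^+ 2)
  | K1_y : K1_rel y b.

Inductive K2_rel : word Kgen -> word Kgen -> Prop :=
  | K2_x4 : K2_rel (x ^+ 4) (y ^+ 2)
  | K2_a4 : K2_rel (a ^+ 4) (b ^+ 2)
  | K2_yx : K2_rel (y * x * y^-1) x^-1
  | K2_ba : K2_rel (b * a * b^-1) a^-1
  | K2_x2 : K2_rel (x ^+ 2) b
  | K2_y : K2_rel y (a ^+ 2 * b).

Definition K1 : groupType := presented K1_rel.
Definition K2 : groupType := presented K2_rel.

(* Main.v *)
From HB Require Import structures.
Require Import Defs.
From mathcomp Require Import all_boot order ssralg ssrnum ssrint zify boolp.

Set Implicit Arguments.
Unset Strict Implicit.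
Unset Printing Implicit Defensive.

Local Open Scope group_scope.

(** Write s_j for the generators (strands and generators are numbered from 0),
    alpha = s_0 ... s_(n-2), Delta for Garside's half twist of the n strands
    and T = Delta ^+ 2 for the full twist.

    Both K1 and K2 are extensions of the quaternion group Q generated by x ^+ 2
    and y by an infinite dihedral group, generated by the classes of x and a.
    Hence a morphism from one of them is injective as soon as x ^+ 4 and all
    powers of x * a^-1 survive ([embedding_criterion]): a nontrivial kernel
    would contain either the central involution x ^+ 4 of Q or, up to an element
    of Q, a power of x * a^-1.

    Finding x, y, a.  A rotation of the sphere by a quarter turn that permutes
    the n points gives a braid x with x ^+ 4 = T, and half turns about
    orthogonal axes give braids inverting x.  In all cases a is z x z^-1:
    - for K1, z has to commute with x ^+ 2 and with y = Delta.  Four arcs of k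
      points each are permuted by x; z is the product of the half twists of two
      complementary pairs of adjacent arcs ([K1_from_rotation]).  For n = 4k all
      points lie on the equator and x = alpha ^+ k, for n = 4k + 2 the poles
      are occupied as well ([polar_rotation]);
    - for K2, z has to send x ^+ 2 to c * x ^+ 2, where c inverts x, commutes
      with z and has square x ^+ 4 ([K2_embeds]).  For n = 4k, z is the half
      twist of half of the points: all that is needed is the factorisation of
      alpha ^+ 2k into half twists ([rotationX]).  For n = 4k + 2, each of the
      three axes of Q carries two of the points, as in an octahedron, and z is
      a quarter turn of a square of four such points around a block of n / 2 - 2
      points, combined with the half twist of this block ([square_turn],
      [twisted_turn]).  The block has more than one point because n >= 10;
      otherwise x and a would generate a finite group.

    Nontriviality.  Forgetting all strands but m of them is not a morphism on
    braids that move the chosen strands, but keeping track of which positions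
    are occupied by the chosen strands makes it an action of the whole braid
    group on pairs (m marked positions, element of a group H), whenever H
    contains elements that satisfy the relations of the sphere braid group on m
    strands ([braid_action]).  Half twists act through half twists of the
    marked strands ([tracks_half_twist]).  With m = 3 and all generators sent to
    an element of order 4, T acts as a sixth power of it, so T <> 1
    ([full_twist_neq1]).  With m = 4 and one marked strand in each of the four
    arcs, x * a^-1 acts through an element of the modular group, represented
    here on integral binary quadratic forms; this element makes the sum of the
    outer coefficients grow on a cone of forms, so it has infinite order
    ([growing_infinite]). *)

(** * Words in a sequence of elements *)
Section Words.
Variables (G : groupType) (s : nat -> G).

Definition asc p l : G := \prod_(i < l) s (p + i).
Definition desc p l : G := \prod_(i < l) s (p + (l - i.+1)).
(** Garside's half twist of the l strands p, ..., p + l - 1. *)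
Definition half_twist p l : G := \prod_(i < l) asc p (l - i.+1).

Lemma asc0 p : asc p 0 = 1. Proof. exact: big_ord0. Qed.
Lemma desc0 p : desc p 0 = 1. Proof. exact: big_ord0. Qed.
Lemma half_twist0 p : half_twist p 0 = 1. Proof. exact: big_ord0. Qed.

Lemma ascS p l : asc p l.+1 = asc p l * s (p + l).
Proof. exact: big_ord_recr. Qed.

Lemma descS p l : desc p l.+1 = s (p + l) * desc p l.
Proof. by rewrite [LHS]big_ord_recl subn1. Qed.

Lemma half_twistS p l : half_twist p l.+1 = asc p l * half_twist p l.
Proof. by rewrite [LHS]big_ord_recl subn1. Qed.

Local Definition wordE := (asc0, desc0, half_twist0, ascS, descS, half_twistS).

Lemma ascD p a b : asc p (a + b) = asc p a * asc (p + a) b.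
Proof.
elim: b => [|b IH]; rewrite ?addn0 ?wordE ?mulg1 //.
by rewrite addnS !wordE IH addnA mulgA.
Qed.

Lemma descD p a b : desc p (a + b) = desc (p + a) b * desc p a.
Proof.
elim: b => [|b IH]; rewrite ?addn0 ?wordE ?mul1g //.
by rewrite addnS !wordE IH addnA mulgA.
Qed.

Lemma asc1 p : asc p 1 = s p. Proof. by rewrite !wordE mul1g addn0. Qed.
Lemma desc1 p : desc p 1 = s p. Proof. by rewrite !wordE mulg1 addn0. Qed.

Lemma ascSl p l : asc p l.+1 = s p * asc p.+1 l.
Proof. by rewrite -add1n ascD asc1 addn1. Qed.

Lemma descSr p l : desc p l.+1 = desc p.+1 l * s p.
Proof. by rewrite -add1n descD desc1 addn1. Qed.

Lemma half_twist1 p : half_twist p 1 = 1. Proof. by rewrite !wordE mulg1. Qed.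

(** Conjugations are handled as intertwining relations u * v = w * u, which
    extend from letters to words; this avoids inverses. *)
Lemma asc_intertwine u p q l :
  (forall t, t < l -> u * s (p + t) = s (q + t) * u) ->
  u * asc p l = asc q l * u.
Proof.
elim: l => [|l IH] us; rewrite !wordE ?mulg1 ?mul1g //.
have {}IH : u * asc p l = asc q l * u.
  by apply: IH => t tl; apply: us; apply: ltnW.
by rewrite mulgA IH -!mulgA us.
Qed.

Lemma desc_intertwine u p q l :
  (forall t, t < l -> u * s (p + t) = s (q + t) * u) ->
  u * desc p l = desc q l * u.
Proof.
elim: l => [|l IH] us; rewrite !wordE ?mulg1 ?mul1g //.
have {}IH : u * desc p l = desc q l * u.
  by apply: IH => t tl; apply: us; apply: ltnW.
by rewrite mulgA us // -!mulgA IH.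
Qed.

Lemma half_twist_intertwine u p q l :
  (forall t, t.+1 < l -> u * s (p + t) = s (q + t) * u) ->
  u * half_twist p l = half_twist q l * u.
Proof.
elim: l => [|l IH] us; rewrite !wordE ?mulg1 ?mul1g //.
rewrite mulgA (@asc_intertwine _ _ q); last by move=> t tl; apply: us.
by rewrite -!mulgA IH // => t tl; apply: us; apply: ltnW.
Qed.

Lemma asc_flip u p q l :
  (forall t, t < l -> u * s (p + t) = s (q + (l.-1 - t)) * u) ->
  u * asc p l = desc q l * u.
Proof.
elim: l q => [|l IH] q us; first by rewrite !wordE mulg1 mul1g.
have {}IH : u * asc p l = desc q.+1 l * u.
  by apply: IH => t tl; rewrite us; [congr (s _ * u)|]; lia.
by rewrite descSr wordE mulgA IH -!mulgA us // subnn addn0.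
Qed.

Lemma intertwineX (u v : G) w k : u * v = w * u -> u * v ^+ k = w ^+ k * u.
Proof.
move=> uv; elim: k => [|k IH]; rewrite ?mulg1 ?mul1g //.
by rewrite !expgS mulgA uv -!mulgA IH.
Qed.

Lemma intertwineV (u v w : G) : u * v = w * u -> u * v^-1 = w^-1 * u.
Proof. by move=> uv; apply: (mulIg v); rewrite mulgVK -mulgA uv mulKg. Qed.

Lemma intertwine_inv (u v w : G) : u * v = w * u -> u^-1 * w = v * u^-1.
Proof. by move=> uv; apply: (mulIg u); rewrite mulgVK -mulgA -uv mulKg. Qed.

Lemma asc_commute u p l :
  (forall j, p <= j < p + l -> commute u (s j)) -> commute u (asc p l).
Proof. by move=> us; apply: asc_intertwine => t tl; apply: us; lia. Qed.

Lemma desc_commute u p l :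
  (forall j, p <= j < p + l -> commute u (s j)) -> commute u (desc p l).
Proof. by move=> us; apply: desc_intertwine => t tl; apply: us; lia. Qed.

Lemma half_twist_commute u p l :
  (forall j, p <= j < (p + l).-1 -> commute u (s j)) ->
  commute u (half_twist p l).
Proof. by move=> us; apply: half_twist_intertwine => t tl; apply: us; lia. Qed.

End Words.

(** * Half twists and rotations *)
Section Braids.
Variables (G : groupType) (s : nat -> G) (N : nat).
Hypothesis far : forall i j, i.+1 < j -> j < N -> commute (s i) (s j).
Hypothesis near :
  forall i, i.+1 < N -> s i * s i.+1 * s i = s i.+1 * s i * s i.+1.

Local Notation asc := (asc s).
Local Notation desc := (desc s).
Local Notation half_twist := (half_twist s).

Lemma far_asc p l j : p + l <= N -> j < N -> (j.+1 < p) || (p + l < j) ->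
  commute (s j) (asc p l).
Proof.
move=> plN jN jpl; apply: asc_commute => i ipl.
by case: (ltnP j i) => ij; [|apply: commute_sym]; apply: far; lia.
Qed.

Lemma far_desc p l j : p + l <= N -> j < N -> (j.+1 < p) || (p + l < j) ->
  commute (s j) (desc p l).
Proof.
move=> plN jN jpl; apply: desc_commute => i ipl.
by case: (ltnP j i) => ij; [|apply: commute_sym]; apply: far; lia.
Qed.

Lemma far_half_twist p l j :
  p + l <= N.+1 -> j < N -> (j.+1 < p) || (p + l <= j) ->
  commute (s j) (half_twist p l).
Proof.
move=> plN jN jpl; apply: half_twist_commute => i ipl.
by case: (ltnP j i) => ij; [|apply: commute_sym]; apply: far; lia.
Qed.

(** A crossing of two strands slides along the strand that [asc p l] takes past
    them, and is shifted by one position. *)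
Lemma asc_shift p l j : p + l <= N -> p <= j -> j.+1 < p + l ->
  asc p l * s j = s j.+1 * asc p l.
Proof.
move=> plN pj jl; have ->: l = j - p + (2 + (p + l - j.+2)) by lia.
rewrite !ascD !(ascS _ _ 1, ascS _ _ 0) asc0 mul1g !addn0 !addn1 addn2.
rewrite subnKC //.
set u := asc p _; set v := asc _ _.
have vj: commute v (s j) by apply/commute_sym/far_asc; lia.
have uj: commute u (s j.+1) by apply/commute_sym/far_asc; lia.
rewrite -!mulgA vj [RHS]mulgA -uj -!mulgA; congr (_ * _).
by rewrite !mulgA near //; lia.
Qed.

Lemma desc_shift p l j : p + l <= N -> p <= j -> j.+1 < p + l ->
  desc p l * s j.+1 = s j * desc p l.
Proof.
move=> plN pj jl; have ->: l = j - p + (2 + (p + l - j.+2)) by lia.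
rewrite !descD !(descS _ _ 1, descS _ _ 0) desc0 mulg1 !addn0 !addn1 addn2.
rewrite subnKC //.
set u := desc p _; set v := desc _ _.
have vj: commute v (s j) by apply/commute_sym/far_desc; lia.
have uj: commute u (s j.+1) by apply/commute_sym/far_desc; lia.
rewrite -!mulgA uj [RHS]mulgA -vj -!mulgA; congr (_ * _).
by rewrite !mulgA -near //; lia.
Qed.

Lemma half_twistSr p l : p + l <= N ->
  half_twist p l.+1 = half_twist p l * desc p l.
Proof.
elim: l => [|l IH] plN; first by rewrite !wordE mulg1.
rewrite half_twistS.
have c : commute (s (p + l)) (half_twist p l) by apply: far_half_twist; lia.
rewrite {1}IH; last by lia.
by rewrite half_twistS ascS descS !mulgA -(mulgA _ _ (half_twist p l)) c !mulgA.
Qed.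

(** The half twist reverses the order of the strands, so conjugation by it
    reverses the order of the generators. *)
Lemma half_twist_flip p l t : p + l <= N.+1 -> t.+1 < l ->
  half_twist p l * s (p + t) = s (p + (l - t.+2)) * half_twist p l.
Proof.
elim: l t => // l IH t plN tl.
rewrite half_twistS.
case: (ltnP t.+1 l) => [tl'|lt].
  rewrite -mulgA IH //; last by lia.
  rewrite mulgA asc_shift; [|lia..].
  by rewrite !mulgA; congr (s _ * _ * _); lia.
have {lt tl} lE : l = t.+1 by lia.
rewrite lE subnn addn0 in plN *.
rewrite half_twistS.
have c : commute (s (p + t)) (half_twist p t) by apply: far_half_twist; lia.
have sh : asc p.+1 t * asc p t.+1 = asc p t.+1 * asc p t.
  apply/esym/asc_intertwine => i it.
  by rewrite asc_shift; [|lia..].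
rewrite -!mulgA -c !mulgA; congr (_ * _).
by rewrite -[LHS]mulgA -[asc p t * s _]ascS {1}ascSl -[LHS]mulgA sh mulgA.
Qed.

Lemma half_twistSl p l : p + l <= N ->
  half_twist p l.+1 = desc p l * half_twist p.+1 l.
Proof.
move=> plN; rewrite half_twistSr //; apply/esym/half_twist_intertwine => t tl.
by rewrite addSn desc_shift; [|lia..].
Qed.

Lemma half_twistSasc p l : p + l <= N ->
  half_twist p l.+1 = half_twist p.+1 l * asc p l.
Proof.
move=> plN; rewrite half_twistS; apply: half_twist_intertwine => t tl.
by rewrite addSn asc_shift; [|lia..].
Qed.

(** Turning n points on a circle by j steps exchanges a block of n - j points
    with a block of j points.  So does the half twist of all points, in which
    both blocks make a half turn.  In the rotation, the first block does not
    turn, and the last one makes a full turn because its points pass one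
    another: the last two factors account for this.  The case j = n says that
    alpha ^+ n is the full twist. *)
Lemma rotationX p n j : 0 < n -> p + n <= N.+1 -> j <= n ->
  asc p n.-1 ^+ j =
  half_twist p n * (half_twist p (n - j))^-1 * half_twist (p + (n - j)) j.
Proof.
move=> n0 pnN; elim: j => [|j IH] jn.
  by rewrite subn0 mulgV half_twist0 mulg1.
set m := n - j.+1; have nj : n - j = m.+1 by lia.
rewrite expgSr {}IH; last by lia.
rewrite half_twistS.
have sh : half_twist (p + (n - j)) j * asc p n.-1 =
    asc p n.-1 * half_twist (p + m) j.
  apply/esym/half_twist_intertwine => t tj.
  by rewrite asc_shift ?nj ?addnS //; lia.
rewrite -mulgA sh nj !mulgA; congr (_ * _).
have -> : n.-1 = m + j by lia.
by rewrite ascD !mulgA half_twistS invgM -!mulgA mulKg.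
Qed.

(** The recursive definition of the half twist is not symmetric under the
    reversal of the strands; [half_twistSl] makes up for it. *)
Lemma half_twist_reverse u p q l : q + l <= N.+1 ->
  (forall t, t.+1 < l -> u * s (p + t) = s (q + (l - t.+2)) * u) ->
  u * half_twist p l = half_twist q l * u.
Proof.
elim: l q => [|l IH] q qlN us; first by rewrite !half_twist0 mulg1 mul1g.
rewrite half_twistS half_twistSl; last by lia.
rewrite mulgA (@asc_flip _ _ _ _ q); last first.
  by move=> t tl; rewrite us //; congr (s _ * u); lia.
rewrite -!mulgA (IH q.+1) //; first by lia.
by move=> t tl; rewrite us; [congr (s _ * u)|]; lia.
Qed.

Lemma half_twist2C p l j : p + l <= N.+1 -> p <= j < (p + l).-1 ->
  commute (half_twist p l ^+ 2) (s j).
Proof.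
move=> plN pj; have -> : j = p + (j - p) by lia.
rewrite /commute expg2 -mulgA half_twist_flip ?mulgA ?half_twist_flip; [|lia..].
by rewrite -!mulgA; congr (s _ * _); lia.
Qed.

Lemma asc_shiftX p l k j : p + l <= N -> p <= j -> j + k < p + l ->
  asc p l ^+ k * s j = s (j + k) * asc p l ^+ k.
Proof.
move=> plN pj; elim: k => [|k IH] jk; first by rewrite addn0 mulg1 mul1g.
by rewrite expgS -!mulgA IH ?mulgA ?asc_shift ?addnS //; lia.
Qed.

(** From here on the sphere relation holds; the number of strands is N + 1. *)
Hypothesis sphere : asc 0 N * desc 0 N = 1.

Local Notation alpha := (asc 0 N).
Local Notation Delta := (half_twist 0 N.+1).

Lemma alphaV : alpha^-1 = desc 0 N.
Proof. exact: mulg1_eq sphere. Qed.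

Lemma Delta_flip t : t < N -> Delta * s t = s (N.-1 - t) * Delta.
Proof.
by move=> tN; rewrite (@half_twist_flip 0); [congr (s _ * _)|..]; lia.
Qed.

Lemma Delta_alpha : Delta * alpha = alpha^-1 * Delta.
Proof. by rewrite alphaV; apply: asc_flip => t tN; rewrite Delta_flip. Qed.

Lemma alphaXn : alpha ^+ N.+1 = Delta ^+ 2.
Proof. by rewrite (@rotationX 0 N.+1) // subnn half_twist0 invg1 mulg1. Qed.

Lemma Delta2C j : j < N -> commute (Delta ^+ 2) (s j).
Proof. by move=> jN; apply: half_twist2C; lia. Qed.

(** rho stands for a rotation of order 4k modulo the centre that fixes the first
    c and the last c strands.  Its power 2k and Delta both exchange the half
    twists of the two blocks of 2k strands in the middle, so the product of
    these half twists commutes with a quaternion group. *)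
Section Halves.
Variables (k c : nat) (rho : G).
Hypothesis NE : N.+1 = 4 * k + 2 * c.
Hypothesis rhoX : rho ^+ (4 * k) = Delta ^+ 2.
Hypothesis rho_shift : forall t, t.+1 < 2 * k ->
  rho ^+ (2 * k) * s (c + t) = s (c + 2 * k + t) * rho ^+ (2 * k).

Local Notation D := (half_twist c (2 * k)).
Local Notation D' := (half_twist (c + 2 * k) (2 * k)).

Lemma rho_halves : rho ^+ (2 * k) * D = D' * rho ^+ (2 * k).
Proof. exact: half_twist_intertwine. Qed.

Lemma rho_halves' : rho ^+ (2 * k) * D' = D * rho ^+ (2 * k).
Proof.
apply: (mulIg (rho ^+ (2 * k))); rewrite -mulgA -rho_halves mulgA -expgnDr.
rewrite -mulgA -expgnDr -mulnDl rhoX.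
by apply/half_twist_commute => j jk; apply: Delta2C; lia.
Qed.

Lemma Delta_halves : Delta * D = D' * Delta.
Proof.
apply: half_twist_reverse => [|t tk]; first by lia.
by rewrite Delta_flip; [congr (s _ * _)|]; lia.
Qed.

Lemma Delta_halves' : Delta * D' = D * Delta.
Proof.
apply: half_twist_reverse => [|t tk]; first by lia.
by rewrite Delta_flip; [congr (s _ * _)|]; lia.
Qed.

Lemma halves_commute : commute D D'.
Proof.
apply/half_twist_commute => j jk; apply/commute_sym.
by apply: far_half_twist; lia.
Qed.

Lemma rho_halvesC : commute (D * D') (rho ^+ (2 * k)).
Proof.
apply/commute_sym; rewrite /commute mulgA rho_halves -mulgA rho_halves'.
by rewrite mulgA -halves_commute.
Qed.

Lemma Delta_halvesC : commute (D * D') Delta.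
Proof.
apply/commute_sym; rewrite /commute mulgA Delta_halves -mulgA Delta_halves'.
by rewrite mulgA -halves_commute.
Qed.

End Halves.

(** ** Rotations with both poles occupied *)
Section TwoPoles.
Local Notation gamma := (asc 1 N.-1).
(** The points 1, ..., N - 1 turn by one step while 0 and N, the poles, stay:
    squaring the last letter of gamma makes the moving point go around N. *)
Definition polar_rotation : G := gamma * s N.-1.

Lemma polar_rotationX j : j < N ->
  polar_rotation ^+ j = gamma ^+ j * asc (N - j) j.
Proof.
elim: j => [|j IH] jN; first by rewrite asc0 mulg1.
rewrite expgSr {}IH; last by lia.
have sh : gamma * asc (N - j.+1) j = asc (N - j) j * gamma.
  by apply: asc_intertwine => t tj; rewrite asc_shift;
    [congr (s _ * _)|..]; lia.
rewrite /polar_rotation !mulgA -[_ * asc _ j * gamma]mulgA -sh !mulgA -expgSr.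
by rewrite -mulgA ascS; congr (_ * (_ * s _)); lia.
Qed.

(** The two full twists differ by the first strand going once around all the
    others, which is trivial on the sphere. *)
Lemma Delta2_half_twist : Delta ^+ 2 = half_twist 1 N ^+ 2.
Proof.
rewrite expg2 {1}half_twistSasc // half_twistSl //.
by rewrite -mulgA [alpha * _]mulgA sphere mul1g.
Qed.

Lemma polar_rotation_full : 1 < N -> polar_rotation ^+ N.-1 = Delta ^+ 2.
Proof.
move=> N1; rewrite polar_rotationX; last by lia.
have -> : (N - N.-1 = 1)%N by lia.
rewrite -expgSr prednK; last by lia.
rewrite rotationX; [|lia..].
by rewrite subnn half_twist0 invg1 mulg1 addn0 Delta2_half_twist.
Qed.

Lemma Delta_polar_rotation : 1 < N ->
  Delta * polar_rotation = polar_rotation^-1 * Delta.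
Proof.
move=> N1; rewrite /polar_rotation mulgA (@asc_flip _ _ _ _ 0); last first.
  by move=> t tN; rewrite Delta_flip; [congr (s _ * _)|]; lia.
rewrite -!mulgA Delta_flip ?mulgA; last by lia.
rewrite subnn; congr (_ * _); apply/esym/mulg1_eq.
have N0 : 0 < N by lia.
have descN : desc 0 N = s N.-1 * desc 0 N.-1 by rewrite -{1}(prednK N0) descS.
apply: (mulgI (s 0)); rewrite mulg1 -[RHS]mul1g -sphere descN.
by rewrite !mulgA -ascSl prednK.
Qed.

Lemma polar_rotation_shift k j : 0 < j -> j + k < N.-1 ->
  polar_rotation ^+ k * s j = s (j + k) * polar_rotation ^+ k.
Proof.
move=> j0; elim: k => [|k IH] jk; first by rewrite addn0 mulg1 mul1g.
have step : polar_rotation * s (j + k) = s (j + k.+1) * polar_rotation.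
  rewrite /polar_rotation -mulgA -(@far (j + k) N.-1); [|lia..].
  by rewrite addnS mulgA (@asc_shift _ _ (j + k)) ?mulgA //; lia.
by rewrite expgS -mulgA IH 1?mulgA ?step ?mulgA //; lia.
Qed.

End TwoPoles.

(** ** The octahedral configuration

    N + 1 = 2h points: four vertices of an octahedron that form a square, at the
    positions 0, 1, h and h + 1, in the cyclic order 0, h, h + 1, 1; and, around
    each of the other two vertices, a block of h - 2 points, at the positions
    2, ..., h - 1 (Inner) and h + 2, ..., 2h - 1 (Outer).  The square separates
    Inner from Outer. *)
Section Octahedron.
Variable h : nat.
Hypotheses (h_ge3 : 2 < h) (NE : N.+1 = (2 * h)%N).

Local Notation Inner := (half_twist 2 (h - 2)).
Local Notation Outer := (half_twist (h + 2) (h - 2)).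
(** The quarter turn of the square around Inner, which is pushed aside and back;
    Outer stays where it is. *)
Definition square_turn : G := asc 0 h.-1 * desc 1 h.
(** A rotation of the 2h - 2 points other than 1 and h, which lie at its poles.
    The two additional crossings put the points 1 and h, which alpha moves
    along with the others, back in their places. *)
Definition tilted_rotation : G := (s 1)^-1 * s h * alpha.

Lemma square_turnC_I : commute square_turn Inner.
Proof.
apply: half_twist_commute => j jh.
rewrite /commute /square_turn -mulgA; have -> : j = j.-1.+1 by lia.
rewrite desc_shift; [|lia..].
by rewrite mulgA asc_shift; [rewrite mulgA|lia..].
Qed.

Lemma square_turnC_O : commute square_turn Outer.
Proof.
apply: half_twist_commute => j jh; apply/commute_sym/commuteM.
  by apply: far_asc; lia.
by apply: far_desc; lia.
Qed.

Lemma half_twist_disjointC l m p q : p + l <= q -> q + m <= N.+1 ->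
  commute (half_twist p l) (half_twist q m).
Proof.
move=> plq qmN; apply: half_twist_commute => j jq; apply/commute_sym.
by apply: far_half_twist; lia.
Qed.

(** Turning the square by two quarter turns and Inner by a half turn is a half
    turn of the whole disc that contains them. *)
Lemma square_turn2 : square_turn ^+ 2 * Inner = half_twist 0 (h + 2).
Proof.
have [q hE] : exists q, h = q.+3 by exists (h - 3); lia.
rewrite expg2 /square_turn hE /= !subSS subn0 addnC.
have swing : s q.+3 * desc 1 q.+2 * asc 0 q.+2 * s q.+3 =
  s q.+2 * s q.+3 * desc 0 q.+3 * asc 1 q.+1.
  have c1 : commute (s q.+3) (desc 1 q.+1) by apply: far_desc; lia.
  have c2 : commute (s q.+3) (asc 0 q.+2) by apply: far_asc; lia.
  rewrite -!mulgA -c2 descS add1n -!mulgA [desc 1 q.+1 * _]mulgA -c1.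
  rewrite !mulgA -near; last by lia.
  rewrite -!mulgA; congr (_ * (_ * _)).
  by rewrite (descSr s 0) (ascSl s 0) (descS s 1 q.+1) add1n !mulgA.
rewrite (half_twistS s 0 q.+4) (@half_twistSl 0 q.+3); last by lia.
rewrite (@half_twistSr 1 q.+2) ?(half_twistS s 1 q.+1); last by lia.
rewrite -[asc 1 _ * _ * _]mulgA.
have -> : half_twist 1 q.+1 * desc 1 q.+2 = desc 1 q.+2 * half_twist 2 q.+1.
  apply/esym/half_twist_intertwine => t tq.
  by rewrite desc_shift; [|lia..].
rewrite !mulgA; congr (_ * _).
rewrite (descS s 1 q.+2) add1n !mulgA; congr (_ * _).
rewrite (ascS s 0 q.+3) (ascS s 0 q.+2) !add0n -!mulgA; congr (_ * _).
by rewrite !mulgA swing.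
Qed.

(** Collecting the powers of alpha on the right spreads the corrections at the
    two poles over the letters 1, ..., j and h, ..., h + j - 1, which commute
    with each other as long as j <= h - 2. *)
Lemma tilted_rotationX j : j <= h - 2 ->
  tilted_rotation ^+ j = (desc 1 j)^-1 * asc h j * alpha ^+ j.
Proof.
elim: j => [|j IH] jh; first by rewrite desc0 asc0 invg1 !mulg1.
rewrite expgSr {}IH; last by lia.
have sh1 : alpha ^+ j * (s 1)^-1 = (s (1 + j))^-1 * alpha ^+ j.
  by apply: (mulIg (s 1)); rewrite mulgVK -mulgA asc_shiftX ?mulKg //; lia.
have sh2 : alpha ^+ j * s h = s (h + j) * alpha ^+ j.
  by rewrite asc_shiftX //; lia.
have c : commute (asc h j) (s (1 + j))^-1.
  by apply/commuteV/commute_sym/far_asc; lia.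
rewrite /tilted_rotation expgSr !mulgA -(mulgA _ (alpha ^+ j)) sh1 !mulgA.
rewrite -(mulgA _ (asc h j)) c !mulgA -(mulgA _ (alpha ^+ j)) sh2.
by rewrite descS invgM ascS !mulgA.
Qed.

(** The half turn about the axis through 1 and h.  It exchanges Inner with
    Outer, as alpha ^+ h does; but alpha ^+ h acts on the square without fixed
    vertex, so they differ by a quarter turn. *)
Lemma tilted_rotation_half :
  tilted_rotation ^+ h.-1 = square_turn^-1 * alpha ^+ h.
Proof.
apply: (mulgI square_turn); rewrite mulVKg.
have [m hE] : exists m, h = m.+2 by exists (h - 2); lia.
have mE : (h - 2 = m)%N by lia.
have sh1 : alpha ^+ m * (s 1)^-1 = (s m.+1)^-1 * alpha ^+ m.
  by apply: intertwineV; rewrite asc_shiftX ?add1n //; lia.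
have sh2 : alpha ^+ m * s h = s (h + m) * alpha ^+ m.
  by rewrite asc_shiftX //; lia.
have c1 : commute (s (h + m)) (s m.+1)^-1.
  by apply/commuteV/commute_sym/far; lia.
have c2 : commute (s m.+1) (asc h.+1 m) by apply: far_asc; lia.
have -> : tilted_rotation ^+ h.-1 =
    (desc 1 m)^-1 * (asc h m.+1 * (s m.+1)^-1) * (alpha ^+ m * alpha).
  rewrite hE /= -hE expgSr tilted_rotationX ?mE // /tilted_rotation !mulgA.
  rewrite -(mulgA _ (alpha ^+ m)) sh1 !mulgA.
  rewrite -(mulgA _ (alpha ^+ m)) sh2 !mulgA.
  by rewrite -(mulgA _ (s m.+1)^-1 (s _)) -c1 ascS !mulgA.
have -> : square_turn = asc 0 m.+1 * s h * s m.+1 * desc 1 m.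
  by rewrite /square_turn hE !descS !add1n !mulgA.
have c3 : s m.+1 * (asc h m.+1 * (s m.+1)^-1) = (s h)^-1 * s m.+1 * asc h m.+1.
  rewrite (ascSl s h) -!mulgA (commuteV (commute_sym c2)) !mulgA.
  congr (_ * _); apply: (mulgI (s h)); rewrite -!mulgA mulVKg.
  apply: (mulIg (s m.+1)); rewrite -!mulgA mulVg mulg1 hE.
  by rewrite [LHS]mulgA -near ?mulgA //; lia.
have {}c3 : s h * (s m.+1 * (asc h m.+1 * (s m.+1)^-1)) = s m.+1 * asc h m.+1.
  by rewrite c3 -mulgA mulVKg.
rewrite -!mulgA mulVKg (mulgA (asc h _)) (mulgA (s m.+1)) (mulgA (s h)) c3.
rewrite !mulgA -ascS -{1}hE -{1}(add0n h) -ascD.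
have -> : (h + m.+1 = N)%N by lia.
by rewrite -mulgA -expgSr -expgS hE.
Qed.

(** alpha ^+ h carries the quarter turn around Inner to the quarter turn around
    Outer.  Seen from the other side of the sphere, this is the inverse of the
    first one: this is where the sphere relation enters. *)
Lemma alpha_square_turn :
  alpha ^+ h * square_turn = square_turn^-1 * alpha ^+ h.
Proof.
have [m hE] : exists m, h = m.+2 by exists (h - 2); lia.
have NE' : N = (m.+2 + m.+1)%N by lia.
apply: (mulgI square_turn); rewrite mulVKg.
have e1 : alpha ^+ h * asc 0 m.+1 = asc h m.+1 * alpha ^+ h.
  by apply: asc_intertwine => t tm; rewrite asc_shiftX;
    [congr (s _ * _)|..]; lia.
have e2 : alpha ^+ h * desc 1 m = desc h.+1 m * alpha ^+ h.
  by apply: desc_intertwine => t tm; rewrite asc_shiftX;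
    [congr (s _ * _)|..]; lia.
have e3 : alpha ^+ h * s h = s 0 * alpha ^+ h.
  apply: (mulgI (alpha ^+ h)); rewrite mulgA -expgnDr [RHS]mulgA.
  rewrite (@asc_shiftX 0 N h 0) ?add0n -?mulgA -?expgnDr; [|lia..].
  by rewrite addnn -mul2n -NE alphaXn; apply: Delta2C; lia.
have e4 : alpha * s (N.-1) = (asc 1 N.-1)^-1 * (alpha * alpha).
  apply: (mulgI (asc 1 N.-1)); rewrite mulVKg.
  have sh : alpha * asc 0 N.-1 = asc 1 N.-1 * alpha.
    by apply: asc_intertwine => t tm; rewrite asc_shift;
    [congr (s _ * _)|..]; lia.
  by rewrite mulgA -sh -mulgA; congr (_ * _); rewrite -ascS prednK //; lia.
have qE : square_turn = asc 0 m.+1 * s h * s m.+1 * desc 1 m.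
  by rewrite /square_turn hE !descS !add1n !mulgA.
have e5 : alpha ^+ h * s m.+1 = (asc 1 N.-1)^-1 * (alpha * alpha ^+ h).
  rewrite -{1}(prednK (_ : 0 < h)) ?expgS; last by lia.
  rewrite -mulgA asc_shiftX; [|lia..].
  have -> : (m.+1 + h.-1 = N.-1)%N by lia.
  rewrite mulgA e4 -!mulgA; congr (_ * (_ * _)).
  by rewrite -expgS prednK //; lia.
have e6 : asc 1 N.-1 = asc 1 m.+1 * asc h m.+1.
  by rewrite hE -(add1n m.+1) -ascD; congr (asc 1 _); lia.
have e7 : commute (asc h m.+1) (s 0) by apply/commute_sym/far_asc; lia.
have e8 : desc 0 h * asc 1 m.+1 = asc 0 m.+1 * desc 0 h.
  by apply: asc_intertwine => t tm; rewrite desc_shift; [|lia..].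
have e9 : commute (s h) (asc 0 m.+1) by apply: far_asc; lia.
have -> : alpha ^+ h * square_turn =
  s 0 * (asc 1 m.+1)^-1 * alpha * desc h.+1 m * alpha ^+ h.
  rewrite qE !mulgA e1 -(mulgA _ (alpha ^+ h) (s h)) e3 !mulgA.
  rewrite -(mulgA _ (alpha ^+ h) (s m.+1)) e5 !mulgA.
  rewrite -(mulgA _ (alpha ^+ h) (desc _ _)) e2 !mulgA e7.
  by rewrite e6 invgM -(mulgA _ (asc h m.+1) (_ * _)) mulVKg.
have e10 : square_turn * s 0 = desc 0 h.+1 * asc 1 m.+1.
  rewrite /square_turn -mulgA -descSr !(descS s 0) add0n hE /= -hE.
  by rewrite mulgA -e9 -!mulgA e8.
rewrite !mulgA e10 mulgK -{2}[alpha ^+ h]mul1g -!mulgA [alpha * _]mulgA mulgA.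
congr (_ * _).
rewrite -[desc 0 h.+1](@mulg1_eq _ (alpha * desc h.+1 m)) ?mulVg //.
by rewrite -mulgA -(add0n h.+1) -descD -[RHS]sphere; congr (_ * desc 0 _); lia.
Qed.

(** A substitute for the quarter turn about the axis through the centres of
    Inner and Outer: as the blocks need not have fourfold symmetry, Inner makes
    a half turn and Outer none. *)
Definition twisted_turn : G := square_turn * Inner.
(** The half turn about the axis through the centres of the blocks.  It is the
    commutator of [twisted_turn] with the half turn about the axis through 1
    and h. *)
Definition square_flip : G := square_turn ^+ 2 * Inner * Outer^-1.

(** In the other picture, where all points lie on one circle, [square_flip] is
    simply a half turn about an axis in the plane of the circle. *)
Lemma square_flipE : square_flip = alpha ^- (h - 2) * Delta.
Proof.
rewrite /square_flip square_turn2 -[LHS]invgK; apply: (canLR (@invgK _)).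
rewrite !invgM !invgK (@rotationX 0 N.+1) //; [|lia..].
have -> : (N.+1 - (h - 2))%N = (h + 2)%N by lia.
rewrite mulgA mulKg add0n; apply/commute_sym/commute_sym/commuteV.
by apply/commute_sym/half_twist_disjointC; lia.
Qed.

Lemma square_flip_tilted :
  square_flip * tilted_rotation = tilted_rotation^-1 * square_flip.
Proof.
have shV k j : j + k < N -> alpha ^- k * s (j + k) = s j * alpha ^- k.
  by move=> jk; apply/intertwine_inv/asc_shiftX.
have e1 : Delta * (s 1)^-1 = (s (h.-1 + (h - 2)))^-1 * Delta.
  by apply: intertwineV; rewrite Delta_flip; [congr (s _ * _)|]; lia.
have e2 : Delta * s h = s (0 + (h - 2)) * Delta.
  by rewrite Delta_flip; [congr (s _ * _)|]; lia.
have e3 : alpha ^- (h - 2) * (s (h.-1 + (h - 2)))^-1 =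
    (s h.-1)^-1 * alpha ^- (h - 2).
  by apply: intertwineV; rewrite shV //; lia.
have e4 : alpha ^- (h - 2) * s (0 + (h - 2)) = s 0 * alpha ^- (h - 2).
  by rewrite shV //; lia.
have e5 : alpha^-1 * (s h)^-1 = (s h.-1)^-1 * alpha^-1.
  by apply: intertwineV; rewrite -(shV 1%N h.-1) ?addn1 ?prednK //; lia.
have e6 : alpha^-1 * s 1 = s 0 * alpha^-1 by rewrite -(shV 1%N 0) //; lia.
have -> : tilted_rotation^-1 * square_flip =
    (s h.-1)^-1 * s 0 * (alpha^-1 * square_flip).
  rewrite /tilted_rotation !invgM invgK !mulgA e5.
  by rewrite -(mulgA _ alpha^-1 (s 1)) e6 !mulgA.
have -> : alpha^-1 * square_flip = alpha ^- (h - 2) * (Delta * alpha).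
  by rewrite square_flipE Delta_alpha !mulgA -!invgM -expgS -expgSr.
rewrite square_flipE /tilted_rotation !mulgA -(mulgA _ Delta) e1 !mulgA e3.
rewrite -(mulgA _ Delta (s h)) e2 !mulgA.
by rewrite -(mulgA _ (alpha ^- _) (s _)) e4 !mulgA.
Qed.

Lemma square_flip2 : square_flip ^+ 2 = Delta ^+ 2.
Proof.
have e : Delta * alpha ^- (h - 2) = alpha ^+ (h - 2) * Delta.
  have := intertwineV (intertwineX (h - 2) Delta_alpha).
  by rewrite expVgn invgK.
rewrite square_flipE !expg2 mulgA -(mulgA _ Delta) e.
by rewrite mulgA mulVg mul1g.
Qed.

Lemma tilted_rotation_full : tilted_rotation ^+ h.-1 ^+ 2 = Delta ^+ 2.
Proof.
rewrite tilted_rotation_half expg2 -{1}alpha_square_turn -mulgA mulVKg -expgnDr.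
by rewrite addnn -mul2n -NE alphaXn.
Qed.

Lemma square_turn2C_I : commute (square_turn ^+ 2) Inner.
Proof. exact/commute_sym/commuteX/commute_sym/square_turnC_I. Qed.

Lemma square_flipC_turn : commute square_flip square_turn.
Proof.
apply/commute_sym/commuteM; last exact/commuteV/square_turnC_O.
by apply: commuteM square_turnC_I; apply: commuteX.
Qed.

Lemma square_flipC_I : commute square_flip Inner.
Proof.
apply/commute_sym/commuteM; last by apply/commuteV/half_twist_disjointC; lia.
by apply: commuteM => //; apply/commuteX/commute_sym/square_turnC_I.
Qed.

Lemma twisted_turn_flipC : commute square_flip twisted_turn.
Proof. exact: commuteM square_flipC_turn square_flipC_I. Qed.

(** [twisted_turn] conjugates the half turn about one axis of the octahedron to
    the half turn about another one.  The conjugate by alpha ^+ h of Inner is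
    Outer, so both sides reduce to Inner * alpha ^+ h. *)
Lemma twisted_turn_tilted :
  twisted_turn * tilted_rotation ^+ h.-1 =
  square_flip * tilted_rotation ^+ h.-1 * twisted_turn.
Proof.
have sh : alpha ^+ h * Inner = Outer * alpha ^+ h.
  apply: half_twist_intertwine => t th.
  by rewrite asc_shiftX;
    [congr (s _ * _)|..]; lia.
have qO : commute (square_turn ^+ 2) Outer.
  exact/commute_sym/commuteX/commute_sym/square_turnC_O.
have -> : twisted_turn * tilted_rotation ^+ h.-1 = Inner * alpha ^+ h.
  by rewrite tilted_rotation_half /twisted_turn square_turnC_I -mulgA mulVKg.
have e : alpha ^+ h * twisted_turn = square_turn^-1 * (Outer * alpha ^+ h).
  by rewrite mulgA alpha_square_turn -mulgA sh.
have -> : square_flip * tilted_rotation ^+ h.-1 * twisted_turn =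
    square_flip * ((square_turn ^+ 2)^-1 * (Outer * alpha ^+ h)).
  rewrite -mulgA; congr (_ * _).
  by rewrite tilted_rotation_half -(mulgA square_turn^-1) e mulgA -invgM -expg2.
rewrite /square_flip; move: (square_turn ^+ 2) qO square_turn2C_I => q2 qO qI.
rewrite qI -!mulgA; congr (_ * _).
by rewrite mulgA (commuteV qO) -mulgA mulVKg mulKg.
Qed.

End Octahedron.

End Braids.

(** * Groups given by generators and relations *)
Section Presentations.
Local Open Scope quotient_scope.
Variables (T : choiceType) (R : word T -> word T -> Prop).

Definition word_class (w : word T) : presented R := \pi_(presented R) w.
Definition gen (t : T) : presented R := word_class (letter t).

Lemma word_classM : {morph word_class : u v / u * v}.
Proof.
move=> u v; apply/presentedP/PresSym.
by apply: PresMul; apply: pres_eq_repr.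
Qed.

Lemma word_class1 : word_class 1 = 1. Proof. by []. Qed.

Lemma word_classV w : word_class w^-1 = (word_class w)^-1.
Proof.
apply/esym/mulg1_eq; rewrite -word_classM; apply/presentedP; exact: PresV.
Qed.

HB.instance Definition _ := isUMagmaMorphism.Build (word T) (presented R)
  word_class (word_class1, word_classM).

Lemma word_classX w n : word_class (w ^+ n) = word_class w ^+ n.
Proof. exact: gmulfXn. Qed.

Lemma word_class_prod m (w : 'I_m -> word T) :
  word_class (\prod_(i < m) w i) = \prod_(i < m) word_class (w i).
Proof. exact: gmulf_prod. Qed.

Lemma word_class_rel u v : R u v -> word_class u = word_class v.
Proof. by move=> uv; apply/presentedP/PresRel. Qed.

Lemma presented_ind (P : presented R -> Prop) : P 1 ->
  (forall t q, P q -> P (gen t * q)) ->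
  (forall t q, P q -> P ((gen t)^-1 * q)) ->
  forall q, P q.
Proof.
move=> P1 Pg PV q; rewrite -[q]reprK -/(word_class _).
elim: {q}(repr q) => [|[b t] w IH] //.
have -> : word_class ((b, t) :: w) =
    (if b then (gen t)^-1 else gen t) * word_class w.
  rewrite -[LHS]/(word_class (([:: (b, t)] : word T) * w)) word_classM.
  congr (_ * _).
  by case: b; rewrite // -word_classV.
by case: b; [apply: PV | apply: Pg].
Qed.

Section Lift.
Variables (G : groupType) (g : T -> G).

Definition eval_word (w : word T) : G :=
  \prod_(l <- w) (if l.1 then (g l.2)^-1 else g l.2).

Lemma eval_wordM : {morph eval_word : u v / u * v}.
Proof. by move=> u v; rewrite /eval_word big_cat. Qed.

Lemma eval_word1 : eval_word 1 = 1. Proof. exact: big_nil. Qed.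

HB.instance Definition _ := isUMagmaMorphism.Build (word T) G eval_word
  (eval_word1, eval_wordM).

Lemma eval_wordX w n : eval_word (w ^+ n) = eval_word w ^+ n.
Proof. exact: gmulfXn. Qed.

Lemma eval_word_prod m (w : 'I_m -> word T) :
  eval_word (\prod_(i < m) w i) = \prod_(i < m) eval_word (w i).
Proof. exact: gmulf_prod. Qed.

Lemma eval_letter t : eval_word (letter t) = g t.
Proof. exact: big_seq1. Qed.

Lemma eval_wordV w : eval_word w^-1 = (eval_word w)^-1.
Proof.
elim: w => [|[b t] w IH]; first by rewrite eval_word1 invg1 -eval_word1.
rewrite -[(b, t) :: w]/(([:: (b, t)] : word T) * w) invgM !eval_wordM IH invgM.
by congr (_ * _); rewrite /eval_word !big_seq1 /=; case: b; rewrite ?invgK.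
Qed.

Hypothesis gR : forall u v, R u v -> eval_word u = eval_word v.

Lemma eval_pres u v : pres_eq R u v -> eval_word u = eval_word v.
Proof.
elim=> {u v} //.
- by move=> w; rewrite eval_wordM eval_wordV mulgV eval_word1.
- by move=> u v w _ -> _ ->.
- by move=> u u' v v' _ eu _ ev; rewrite !eval_wordM eu ev.
Qed.

Definition presented_map (q : presented R) : G := eval_word (repr q).

Lemma presented_map_class w : presented_map (word_class w) = eval_word w.
Proof. exact/eval_pres/pres_eq_repr. Qed.

Lemma presented_mapM : {morph presented_map : u v / u * v}.
Proof.
move=> u v; rewrite -[u]reprK -[v]reprK -!/(word_class _) -word_classM.
by rewrite !presented_map_class eval_wordM.
Qed.

Lemma presented_map1 : presented_map 1 = 1.
Proof. by rewrite -word_class1 presented_map_class eval_word1. Qed.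

Lemma presented_map_gen t : presented_map (gen t) = g t.
Proof. by rewrite presented_map_class eval_letter. Qed.

End Lift.

(** The universal property of < T | R >. *)
Lemma presented_hom (G : groupType) (g : T -> G) :
  (forall u v, R u v -> eval_word g u = eval_word g v) ->
  exists f : UMagmaMorphism.type (presented R) G, forall t, f (gen t) = g t.
Proof.
move=> gR; pose m := isUMagmaMorphism.Build _ _ (presented_map g)
  (presented_map1 gR, presented_mapM gR).
pose f : UMagmaMorphism.type (presented R) G := HB.pack (presented_map g) m.
by exists f => t; apply: presented_map_gen.
Qed.

End Presentations.

(** * Embedding amalgams of two generalised quaternion groups *)
Section Image.
Variables (K G : groupType) (f : UMagmaMorphism.type K G).

Definition image_pred : pred G := fun g => `[< exists k, f k = g >].

Lemma image_closed : group_closed image_pred.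
Proof.
split=> [|_ _ /asboolP[k <-] /asboolP[l <-]]; apply/asboolP.
  by exists 1; rewrite gmulf1.
by exists (k / l); rewrite gmulfF.
Qed.

Definition image_group : Type := {g | image_pred g}.
HB.instance Definition _ := SubChoice.on image_group.
HB.instance Definition _ :=
  SubChoice_isSubGroup.Build G image_pred image_group image_closed.

Lemma image_isomorphic : injective f ->
  exists (S : pred G) (H : subGroupType S), isomorphic H K.
Proof.
move=> f_inj; exists image_pred, image_group.
have fP (h : image_group) : {k | f k = val h}.
  by apply: cid; case: h => g /= /asboolP.
have imf k : image_pred (f k) by apply/asboolP; exists k.
pose u (h : image_group) : K := sval (fP h).
have uE h : f (u h) = val h by rewrite /u; case: (fP h).
have uM : {morph u : h1 h2 / h1 * h2}.
  by move=> h1 h2; apply: f_inj; rewrite gmulfM !uE valM.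
pose m := isMultiplicative.Build image_group K u uM.
pose u' : {multiplicative image_group -> K} := HB.pack u m.
exists u', (fun k => exist _ (f k) (imf k)) => [h|k].
  by apply: val_inj; rewrite /= uE.
by apply: f_inj; rewrite uE.
Qed.

End Image.

(** K is generated by Q = < x ^+ 2, y > and by two elements x and a that
    normalise Q and have their squares in Q, so K / Q is a quotient of the
    infinite dihedral group. *)
Section Embedding.
Variables (K G : groupType) (f : UMagmaMorphism.type K G) (x y a : K).
Local Notation i := (x ^+ 2).

(** Exponents of y above 1 and negative exponents are superfluous because
    y ^+ 2 = i ^+ 2 and i ^+ 4 = 1. *)
Definition quaternion (q : K) := exists e, q = i ^+ e \/ q = i ^+ e * y.

Hypothesis x8 : x ^+ 8 = 1.
Hypothesis y2 : y ^+ 2 = x ^+ 4.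
Hypothesis yx : y * x = x^-1 * y.
Hypothesis a2 : quaternion (a ^+ 2).
Hypothesis ai : quaternion (a * i * a^-1).
Hypothesis ay : quaternion (a * y * a^-1).
Hypothesis generated : forall P : K -> Prop, P 1 ->
  (forall u q, [\/ u = x, u = y | u = a] -> P q -> P (u * q)) ->
  (forall u q, [\/ u = x, u = y | u = a] -> P q -> P (u^-1 * q)) ->
  forall q, P q.
Hypothesis fx4 : f (x ^+ 4) != 1.
Hypothesis fxa : forall m, f (x * a) ^+ m.+1 != 1.

Let i4 : i ^+ 4 = 1. Proof. by rewrite -expgnA. Qed.
Let i2 : i ^+ 2 = x ^+ 4. Proof. by rewrite -expgnA. Qed.

Let yi e : y * i ^+ e = i ^+ (3 * e) * y.
Proof.
rewrite expgnA; apply: intertwineX.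
have -> : i ^+ 3 = (x^-1) ^+ 2.
  by apply: (mulIg i); rewrite -expgSr i4 expVgn mulVg.
exact: intertwineX.
Qed.

Lemma quaternionM p q : quaternion p -> quaternion q -> quaternion (p * q).
Proof.
move=> [e [] ->] [e' [] ->].
- by exists (e + e')%N; left; rewrite expgnDr.
- by exists (e + e')%N; right; rewrite expgnDr mulgA.
- by exists (e + 3 * e')%N; right; rewrite (expgnDr i e) -mulgA yi mulgA.
exists (e + 3 * e' + 2)%N; left.
rewrite -mulgA [y * _]mulgA yi -!mulgA -expg2 y2 -i2.
by rewrite (expgnDr i (e + _)) (expgnDr i e) -mulgA.
Qed.

Lemma quaternion1 : quaternion 1. Proof. by exists 0; left. Qed.
Lemma quaternion_i : quaternion i. Proof. by exists 1%N; left. Qed.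
Lemma quaternion_y : quaternion y.
Proof. by exists 0; right; rewrite mul1g. Qed.

(** Every nontrivial element of Q has x ^+ 4 among its powers, so x ^+ 4 decides
    whether a morphism is injective on Q. *)
Lemma quaternion2 q : quaternion q -> q = 1 \/ q = x ^+ 4 \/ q ^+ 2 = x ^+ 4.
Proof.
case=> e [] ->; last first.
  right; right; rewrite expg2 -mulgA [y * _]mulgA yi -!mulgA -expg2 y2 -i2.
  rewrite -!expgnDr; have -> : (e + (3 * e + 2) = 4 * e + 2)%N by lia.
  by rewrite expgnDr expgnA i4 expg1n mul1g.
have -> : e = (4 * (e %/ 4) + e %% 4)%N by lia.
have : e %% 4 < 4 by lia.
rewrite expgnDr expgnA i4 expg1n mul1g -i2.
case: (e %% 4) => [|[|[|[|//]]]] _; [by left|by right; right|by right; left|].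
by right; right; rewrite -expgnA (expgnDr i 4 2) i4 mul1g.
Qed.

Lemma quaternion4 q : quaternion q -> q ^+ 4 = 1.
Proof.
case/quaternion2 => [->|[->|q2]]; first by rewrite expg1n.
  by rewrite -expgnA (expgnA x 8 2) x8 expg1n.
by rewrite (expgnA q 2 2) q2 -expgnA.
Qed.

Lemma quaternionV q : quaternion q -> quaternion q^-1.
Proof.
move=> Qq; have -> : q^-1 = q ^+ 3.
  by apply: (mulIg q); rewrite mulVg -expgSr quaternion4.
by rewrite !expgS mulg1; do 2?apply: quaternionM.
Qed.

Definition normalizing (u : K) :=
  forall q, quaternion q -> quaternion (u * q * u^-1).

Lemma normalizingP u : quaternion (u * i * u^-1) -> quaternion (u * y * u^-1) ->
  normalizing u.
Proof.
move=> ui uy q [e qE].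
have uX : quaternion (u * i ^+ e * u^-1).
  elim: e {qE} => [|e IH]; first by rewrite mulg1 mulgV; apply: quaternion1.
  by have := quaternionM ui IH; rewrite !mulgA mulgVK (expgS i) !mulgA.
case: qE => -> //; have := quaternionM uX uy.
by rewrite !mulgA mulgVK.
Qed.

Lemma normalizing_x : normalizing x.
Proof.
apply: normalizingP; first by rewrite expg2 mulgA mulgK; apply: quaternion_i.
have -> : x * y * x^-1 = i * y.
  by apply: (mulIg x); rewrite mulgVK expg2 -!mulgA yx mulVKg.
exact: quaternionM quaternion_i quaternion_y.
Qed.

Lemma normalizing_a : normalizing a. Proof. exact: normalizingP. Qed.

(** The reduced words x a x ... and a x a ... of length n in the dihedral
    quotient. *)
Fixpoint alternating (b : bool) n : K :=
  if n is m.+1 then (if b then x else a) * alternating (~~ b) m else 1.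

Let letter_norm b : normalizing (if b then x else a).
Proof. by case: b; [apply: normalizing_x|apply: normalizing_a]. Qed.

Let letter2 b : quaternion ((if b then x else a) ^+ 2).
Proof. by case: b; [apply: quaternion_i|]. Qed.

Definition normal_form g :=
  exists q b n, quaternion q /\ g = q * alternating b n.

Lemma normal_formQ q g : quaternion q -> normal_form g -> normal_form (q * g).
Proof.
move=> Qq [q' [b [n [Qq' ->]]]]; exists (q * q'), b, n.
by rewrite mulgA; split=> //; apply: quaternionM.
Qed.

Lemma normal_form_letter (b : bool) g :
  normal_form g -> normal_form ((if b then x else a) * g).
Proof.
move=> [q [c [n [Qq ->]]]].
set u := if b then x else a.
have -> : u * (q * alternating c n) = u * q * u^-1 * (u * alternating c n).
  by rewrite !mulgA mulgVK.
apply: normal_formQ; first exact: letter_norm.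
case: n => [|n].
  by exists 1, b, 1%N; split; [apply: quaternion1|rewrite mul1g].
case: (eqVneq b c) => [bc|bc]; last first.
  exists 1, b, n.+2; split; [exact: quaternion1|rewrite mul1g /=].
  by have -> : ~~ b = c by case: b c bc {u} => -[].
rewrite -bc; exists (u ^+ 2), (~~ b), n; split; first exact: letter2.
by rewrite /= mulgA -expg2.
Qed.

Lemma normal_form_exists g : normal_form g.
Proof.
have letterV (b : bool) h : normal_form h ->
    normal_form ((if b then x else a)^-1 * h).
  move=> nh.
  have := normal_formQ (quaternionV (letter2 b)) (normal_form_letter b nh).
  by rewrite expg2 invgM mulgA mulgVK.
elim/generated: g => [|u q|u q].
- by exists 1, true, 0; split; [apply: quaternion1|rewrite mulg1].
- case=> -> nq; first exact: (@normal_form_letter true).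
    exact: normal_formQ quaternion_y nq.
  exact: (@normal_form_letter false).
- case=> -> nq; first exact: (@letterV true).
    exact: normal_formQ (quaternionV quaternion_y) nq.
  exact: (@letterV false).
Qed.

Lemma alternatingD b m n :
  alternating b (m + n) = alternating b m * alternating (b (+) odd m) n.
Proof.
elim: m b => [|m IH] b; first by rewrite addbF mul1g.
by rewrite addSn /= IH mulgA addNb addbN.
Qed.

Lemma normalizing_alternating b n : normalizing (alternating b n).
Proof.
elim: n b => [|n IH] b q Qq; first by rewrite mul1g invg1 mulg1.
have := letter_norm b (IH (~~ b) q Qq).
by rewrite /= invgM !mulgA.
Qed.

Lemma alternating_even n : alternating true n.*2 = (x * a) ^+ n.
Proof. by elim: n => // n IH; rewrite expgS -IH -mulgA. Qed.

(** As q ^+ 4 = 1, otherwise the image of x * a would have finite order. *)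
Lemma ker_even q n : quaternion q -> f (q * alternating true n.*2) = 1 -> n = 0.
Proof.
case: n => // n Qq; rewrite alternating_even gmulfM => fq.
case/negP: (fxa (n.+1 * 4).-1); apply/eqP.
rewrite prednK // expgnA -gmulfXn -(mulg1_eq fq) -gmulfV -gmulfXn.
by rewrite expVgn quaternion4 // invg1 gmulf1.
Qed.

Lemma ker_alternating_even q b n :
  quaternion q -> f (q * alternating b n.*2) = 1 -> n = 0.
Proof.
case: b => [|Qq fq]; first exact: ker_even.
apply: (@ker_even (x * q * x^-1)); first exact: normalizing_x.
have xalt : x * alternating false n.*2 = alternating true n.*2 * x.
  transitivity (alternating true n.*2.+1) => //.
  by rewrite -addn1 alternatingD odd_double /= mulg1.
rewrite -[alternating true _](mulgK x) -xalt.
have -> : x * q * x^-1 * (x * alternating false n.*2 * x^-1) =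
    x * (q * alternating false n.*2) * x^-1 by rewrite !mulgA mulgVK.
by rewrite 2!gmulfM fq mulg1 -gmulfM mulgV gmulf1.
Qed.

(** A word g of odd length begins and ends with the same letter.  With the other
    letter v in front it has even length; if f kills g, then f identifies
    v * g with v, and (v * g) ^+ 2, which is a word of length 2n + 2 up to Q,
    with the element v ^+ 2 of Q. *)
Lemma ker_alternating q b n :
  quaternion q -> f (q * alternating b n) = 1 -> n = 0.
Proof.
case: (boolP (odd n)) => [n_odd|n_even] Qq fq; last first.
  move: fq; rewrite -(even_halfK n_even) => /(ker_alternating_even Qq) ->.
  by [].
have regroup (p r t : K) :
    p * (r * (t * r * t^-1)) * (t * t) = p * ((r * t) * (r * t)).
  by rewrite !mulgA mulgVK.
pose v := if ~~ b then x else a.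
pose q' := v * q * v^-1.
have vg : v * (q * alternating b n) = q' * alternating (~~ b) n.+1.
  by rewrite /q' /= negbK -/v !mulgA mulgVK.
have Qq' : quaternion q' by apply: letter_norm.
set w := alternating (~~ b) n.+1 in vg.
have ww : w * w = alternating (~~ b) n.+1.*2.
  by rewrite -addnn alternatingD /= n_odd addbF.
have : f ((v ^+ 2)^-1 * (q' * (w * q' * w^-1)) *
    alternating (~~ b) n.+1.*2) = 1.
  rewrite -ww regroup -vg; move: (q * _) fq => g fq.
  by rewrite gmulfM gmulfV gmulfXn !gmulfM fq !mulg1 mulVg.
move/(@ker_alternating_even _ _ n.+1) => n0.
suff /n0 : quaternion ((v ^+ 2)^-1 * (q' * (w * q' * w^-1))) by [].
apply: quaternionM; first exact/quaternionV/letter2.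
by apply: quaternionM => //; apply: normalizing_alternating.
Qed.

(** An element of the kernel is some q in Q times an alternating word; the word
    is empty by [ker_alternating] and q is trivial by [quaternion2]. *)
Lemma embedding_criterion : injective f.
Proof.
apply: gmulf_inj => g; case: (normal_form_exists g) => q [b [n [Qq ->]]] fq.
move: (fq); rewrite (ker_alternating Qq fq) mulg1 {fq} => fq.
case/quaternion2: Qq => [//|[qE|q2]]; case/negP: fx4.
  by rewrite -qE fq.
by rewrite -q2 gmulfXn fq expg1n.
Qed.

End Embedding.

(** y commutes with x ^+ 4 = y ^+ 2 and inverts it. *)
Lemma quaternion_x8 (K : groupType) (x y : K) :
  y ^+ 2 = x ^+ 4 -> y * x = x^-1 * y -> x ^+ 8 = 1.
Proof.
move=> y2 yx; rewrite (expgnDr x 4 4).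
have e : y * x ^+ 4 = x ^- 4 * y by rewrite (intertwineX 4 yx) expVgn.
apply: (mulgI (x ^- 4)); rewrite mulKg mulg1 -y2.
by rewrite -[LHS](mulgK y) -expgSr expgS y2 e mulgK.
Qed.

Section K1.
Local Notation x := (gen K1_rel Kx).
Local Notation y := (gen K1_rel Ky).
Local Notation a := (gen K1_rel Ka).
Local Notation b := (gen K1_rel Kb).

Lemma K1_bE : b = y. Proof. by have := word_class_rel K1_y. Qed.
Lemma K1_a2 : a ^+ 2 = x ^+ 2.
Proof. by have /esym := word_class_rel K1_x2; rewrite !word_classX. Qed.
Lemma K1_y2 : y ^+ 2 = x ^+ 4.
Proof. by have /esym := word_class_rel K1_x4; rewrite !word_classX. Qed.
Lemma K1_yx_eq : y * x = x^-1 * y.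
Proof.
have := word_class_rel K1_yx; rewrite !word_classM !word_classV.
by move/(canRL (mulgVK _)).
Qed.
Lemma K1_ya_eq : y * a = a^-1 * y.
Proof.
have := word_class_rel K1_ba; rewrite !word_classM !word_classV -/b K1_bE.
by move/(canRL (mulgVK _)).
Qed.

(** Conjugating by z, which centralises Q, gives a second quaternion group of
    order 16 that meets the first one in Q. *)
Lemma K1_embeds (G : groupType) (x' y' z' : G) :
  y' ^+ 2 = x' ^+ 4 -> y' * x' = x'^-1 * y' ->
  commute z' (x' ^+ 2) -> commute z' y' -> x' ^+ 4 <> 1 ->
  (forall m, (x' * z' * x'^-1 * z'^-1) ^+ m.+1 <> 1) ->
  exists (S : pred G) (H : subGroupType S), isomorphic H K1.
Proof.
move=> y2 yx zx zy x4 xz.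
pose a' := z' * x' * z'^-1.
have a2 : a' ^+ 2 = x' ^+ 2.
  by rewrite expg2 /a' !mulgA mulgVK -[_ * x' * x']mulgA -expg2 zx mulgK.
have ya : y' * a' = a'^-1 * y'.
  rewrite /a' !mulgA -zy -[z' * y' * x']mulgA yx !invgM invgK.
  by rewrite -!mulgA -(commuteV (commute_sym zy)).
pose g t := match t with Kx => x' | Ka => a' | _ => y' end.
have gR u v : K1_rel u v -> eval_word g u = eval_word g v.
  case; rewrite ?eval_wordX ?eval_wordM ?eval_wordV ?eval_wordX ?eval_letter //.
  - by rewrite [RHS]y2 [LHS](expgnA a' 2 2) a2 -expgnA.
  - by rewrite -[LHS]/(y' * x' * y'^-1) yx mulgK.
  - by rewrite -[LHS]/(y' * a' * y'^-1) ya mulgK.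
have [f fE] := presented_hom gR.
have x8 := quaternion_x8 K1_y2 K1_yx_eq.
(* With a^-1 for a, the criterion is about the commutator of x' and z'. *)
apply: (@image_isomorphic _ _ f); apply: (@embedding_criterion _ _ f x y a^-1).
- exact: x8.
- exact: K1_y2.
- exact: K1_yx_eq.
- exists 3; left; rewrite expVgn K1_a2.
  by apply: (mulIg (x ^+ 2)); rewrite mulVg -expgSr -expgnA x8.
- by exists 1%N; left; rewrite -K1_a2 invgK expg2 mulKg.
- exists 3; right; rewrite invgK -mulgA K1_ya_eq mulgA -invgM -expg2 K1_a2.
  by congr (_ * _); apply: (mulIg (x ^+ 2)); rewrite mulVg -expgSr -expgnA x8.
- move=> P P1 Pm PV; apply: presented_ind => // -[] q Pq.
  + by apply: Pm => //; constructor 1.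
  + by apply: Pm => //; constructor 2.
  + by rewrite -[gen _ _]invgK; apply: PV => //; constructor 3.
  + by rewrite -/b K1_bE; apply: Pm => //; constructor 2.
  + by apply: PV => //; constructor 1.
  + by apply: PV => //; constructor 2.
  + by apply: Pm => //; constructor 3.
  + by rewrite -/b K1_bE; apply: PV => //; constructor 2.
- by apply/eqP; rewrite gmulfXn fE.
move=> m; apply/eqP; rewrite gmulfM gmulfV !fE /= /a' !invgM invgK.
by rewrite !mulgA; apply: xz.
Qed.
End K1.

Section K2.
Local Notation x := (gen K2_rel Kx).
Local Notation y := (gen K2_rel Ky).
Local Notation a := (gen K2_rel Ka).
Local Notation b := (gen K2_rel Kb).

Lemma K2_bE : b = x ^+ 2.
Proof. by have /esym := word_class_rel K2_x2; rewrite !word_classX. Qed.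
Lemma K2_yE : y = a ^+ 2 * x ^+ 2.
Proof.
by have := word_class_rel K2_y; rewrite word_classM word_classX -/b K2_bE.
Qed.
Lemma K2_y2 : y ^+ 2 = x ^+ 4.
Proof. by have /esym := word_class_rel K2_x4; rewrite !word_classX. Qed.
Lemma K2_yx_eq : y * x = x^-1 * y.
Proof.
have := word_class_rel K2_yx; rewrite !word_classM !word_classV.
by move/(canRL (mulgVK _)).
Qed.
Lemma K2_ba_eq : x ^+ 2 * a = a^-1 * x ^+ 2.
Proof.
have := word_class_rel K2_ba; rewrite !word_classM !word_classV -/b K2_bE.
by move/(canRL (mulgVK _)).
Qed.

(** The conjugate a of x by w has the square c * x ^+ 2.  The condition on w
    also gives w^-1 * x ^+ 2 * w = c^-1 * x ^+ 2, which inverts x: this is the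
    relation between b = x ^+ 2 and a. *)
Lemma K2_embeds (G : groupType) (x' w c : G) :
  w * x' ^+ 2 = c * x' ^+ 2 * w -> commute c w -> c * x' = x'^-1 * c ->
  c ^+ 2 = x' ^+ 4 -> x' ^+ 4 <> 1 ->
  (forall m, (x' * w * x'^-1 * w^-1) ^+ m.+1 <> 1) ->
  exists (S : pred G) (H : subGroupType S), isomorphic H K2.
Proof.
move=> wx cw cx c2 x4 xw.
pose a' := w * x' * w^-1.
have a2 : a' ^+ 2 = c * x' ^+ 2.
  have -> : a' ^+ 2 = w * x' ^+ 2 * w^-1 by rewrite !expg2 !mulgA mulgVK.
  by rewrite wx mulgK.
have cxn k : c * x' ^+ k = x' ^- k * c by rewrite (intertwineX k cx) expVgn.
have cxc k : (c * x' ^+ k) ^+ 2 = c ^+ 2.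
  by rewrite !expg2 {2}cxn mulgA mulgK.
have x2w : x' ^+ 2 * w = w * (c^-1 * x' ^+ 2).
  apply: (mulgI c); rewrite mulgA -wx [RHS]mulgA cw.
  by rewrite -[RHS]mulgA mulVKg.
have ba : x' ^+ 2 * a' = a'^-1 * x' ^+ 2.
  have cx' : c^-1 * x' = x'^-1 * c^-1.
    by apply: (mulgI c); rewrite mulVKg mulgA (intertwineV cx) invgK mulgK.
  have xx : commute (x' ^+ 2) x' by apply/commute_sym/commuteX.
  have a'V : a'^-1 = w * x'^-1 * w^-1 by rewrite !invgM invgK mulgA.
  have wV : w^-1 * x' ^+ 2 = c^-1 * x' ^+ 2 * w^-1 := intertwine_inv (esym x2w).
  have cx2 : c^-1 * x' ^+ 2 * x' = x'^-1 * (c^-1 * x' ^+ 2).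
    by rewrite -mulgA xx [LHS]mulgA cx' -mulgA.
  rewrite /a' mulgA (mulgA (x' ^+ 2)) x2w -(mulgA w) cx2 a'V.
  by rewrite -(mulgA (w / x')) wV !mulgA.
pose y' := c * x' ^+ 4.
pose g t := match t with Kx => x' | Ky => y' | Ka => a' | Kb => x' ^+ 2 end.
have gR u v : K2_rel u v -> eval_word g u = eval_word g v.
  case; rewrite ?eval_wordX ?eval_wordM ?eval_wordV ?eval_wordX ?eval_letter //.
  - by rewrite -[RHS]/(y' ^+ 2) cxc c2.
  - rewrite -[LHS]/(a' ^+ 4) (expgnA a' 2 2) a2 cxc c2.
    by rewrite -[RHS]/(x' ^+ 2 ^+ 2) -expgnA.
  - rewrite -[LHS]/(y' * x' * y'^-1); apply: (canLR (mulgK _)).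
    by rewrite /y' -mulgA -(expgSr x' 4) (expgS x' 4) mulgA cx -mulgA.
  - by rewrite -[LHS]/(x' ^+ 2 * a' * x' ^- 2) ba mulgK.
  by rewrite -[RHS]/(a' ^+ 2 * x' ^+ 2) a2 -mulgA -expgnDr.
have [f fE] := presented_hom gR.
have x8 := quaternion_x8 K2_y2 K2_yx_eq.
have iV : x ^- 2 = (x ^+ 2) ^+ 3.
  by apply: (mulIg (x ^+ 2)); rewrite mulVg -expgSr -expgnA x8.
have yi : y * x ^- 2 = x ^+ 2 * y.
  by rewrite (intertwineV (intertwineX 2 K2_yx_eq)) expVgn invgK.
have a2E : a ^+ 2 = x ^+ 2 * y by rewrite -yi K2_yE mulgK.
apply: (@image_isomorphic _ _ f); apply: (@embedding_criterion _ _ f x y a^-1).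
- exact: x8.
- exact: K2_y2.
- exact: K2_yx_eq.
- exists 3; right; rewrite expVgn a2E -iV; apply: mulg1_eq.
  rewrite -{1}yi mulgA -(mulgA y) -invgM -(expgnDr x 2 2) -K2_y2 expg2 invgM.
  by rewrite mulgA mulgV mul1g mulVg.
- exists 2; right; rewrite invgK -K2_ba_eq -(mulgA (x ^+ 2)) -(expg2 a) a2E.
  by rewrite mulgA -expg2.
- exists 1%N; left; rewrite invgK expg1 K2_yE (expg2 a) -!(mulgA a) mulKg.
  by rewrite -mulgA K2_ba_eq mulVKg.
- move=> P P1 Pm PV; apply: presented_ind => // -[] q Pq.
  + by apply: Pm => //; constructor 1.
  + by apply: Pm => //; constructor 2.
  + by rewrite -[gen _ _]invgK; apply: PV => //; constructor 3.
  + rewrite -/b K2_bE expg2 -mulgA.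
    by do 2![apply: (Pm); first by constructor 1].
  + by apply: PV => //; constructor 1.
  + by apply: PV => //; constructor 2.
  + by apply: Pm => //; constructor 3.
  + rewrite -/b K2_bE expg2 invgM -mulgA.
    by do 2![apply: (PV); first by constructor 1].
- by apply/eqP; rewrite gmulfXn fE.
move=> m; apply/eqP; rewrite gmulfM gmulfV !fE /= /a' !invgM invgK.
by rewrite !mulgA; apply: xw.
Qed.
End K2.

(** * Keeping track of some of the strands *)
Section Bijections.
Variable Omega : Type.

Record bijection := Bijection {
  fwd : Omega -> Omega;
  bwd : Omega -> Omega;
  fwdK : cancel fwd bwd;
  bwdK : cancel bwd fwd
}.

HB.instance Definition _ := gen_eqMixin bijection.
HB.instance Definition _ := gen_choiceMixin bijection.

Lemma bijection_ext u v : fwd u =1 fwd v -> u = v.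
Proof.
case: u v => [f g fK gK] [f' g' f'K g'K] /= /funext ff'; subst f'.
have gg' : g = g' by apply/funext => w; rewrite -{1}(g'K w) fK.
by subst g'; rewrite (Prop_irrelevance fK f'K) (Prop_irrelevance gK g'K).
Qed.

Definition bij_mul u v :=
  Bijection (can_comp (fwdK u) (fwdK v)) (can_comp (bwdK v) (bwdK u)).
Definition bij_one := Bijection (frefl id) (frefl id).
Definition bij_inv u := Bijection (bwdK u) (fwdK u).

Fact bij_mulA : associative bij_mul.
Proof. by move=> u v w; apply: bijection_ext. Qed.
Fact bij_mul1 : left_id bij_one bij_mul.
Proof. by move=> u; apply: bijection_ext. Qed.
Fact bij_mulr1 : right_id bij_one bij_mul.
Proof. by move=> u; apply: bijection_ext. Qed.
Fact bij_mulV : left_inverse bij_one bij_inv bij_mul.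
Proof. by move=> u; apply: bijection_ext => w /=; apply: fwdK. Qed.
Fact bij_mulVr : right_inverse bij_one bij_inv bij_mul.
Proof. by move=> u; apply: bijection_ext => w /=; apply: bwdK. Qed.

HB.instance Definition _ :=
  isGroup.Build bijection bij_mulA bij_mul1 bij_mulr1 bij_mulV bij_mulVr.

End Bijections.

Section Markings.

Definition marking := nat -> bool.
Implicit Type s : marking.

(** The number of marked strands to the left of position p, that is the number
    that a marked strand at p has when the others are forgotten. *)
Definition rank s p := \sum_(j < p) s j.

Lemma rankS s p : rank s p.+1 = rank s p + s p.
Proof. exact: big_ord_recr. Qed.

Lemma rank_le s p q : p <= q -> rank s p <= rank s q.
Proof.
move=> /subnKC <-; elim: (q - p) => [|d IH]; rewrite ?addn0 //.
by rewrite addnS rankS; lia.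
Qed.

Definition swap i s : marking :=
  fun j => if j == i then s i.+1 else if j == i.+1 then s i else s j.

(** [move_down], [move_up] and [reverse] are the effects of [asc], [desc] and
    [half_twist] on the positions. *)
Definition move_down p l s : marking :=
  fun j => if j == p then s (p + l) else if p < j <= p + l then s j.-1 else s j.

Definition move_up p l s : marking :=
  fun j => if j == p + l then s p else if p <= j < p + l then s j.+1 else s j.

Definition reverse p l s : marking :=
  fun j => if p <= j < p + l then s (p + (p + l).-1 - j) else s j.

Lemma swap_left i s : swap i s i = s i.+1.
Proof. by rewrite /swap eqxx. Qed.

Lemma swap_right i s : swap i s i.+1 = s i.
Proof. by rewrite /swap ifN ?eqxx //; lia. Qed.

Lemma swap_other i s j : j != i -> j != i.+1 -> swap i s j = s j.
Proof. by move=> /negPf ji /negPf ji1; rewrite /swap ji ji1. Qed.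

Lemma rank_swap i s p :
  rank (swap i s) p = if p == i.+1 then rank s i + s i.+1 else rank s p.
Proof.
have small q : q <= i -> rank (swap i s) q = rank s q.
  move=> qi; apply: eq_bigr => j _; have jq := ltn_ord j.
  by rewrite /swap !ifN //; lia.
have mid : rank (swap i s) i.+1 = rank s i + s i.+1.
  by rewrite rankS small // /swap eqxx.
case: eqP => [->//|pi]; case: (leqP p i) => [/small //|ip].
have -> : p = i + 2 + (p - i.+2) by lia.
elim: (p - i.+2) => [|d IH].
  rewrite addn0 addn2 !rankS small // /swap !eqxx ifN; lia.
by rewrite addnS !rankS IH /swap !ifN //; lia.
Qed.

Lemma rank_swap_other i s p : p != i.+1 -> rank (swap i s) p = rank s p.
Proof. by move=> /negPf pi; rewrite rank_swap pi. Qed.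

Lemma rank_swap_mid i s : rank (swap i s) i.+1 = rank s i + s i.+1.
Proof. by rewrite rank_swap eqxx. Qed.

Lemma move_downS p l s : move_down p l.+1 s = move_down p l (swap (p + l) s).
Proof.
apply/funext => j; rewrite /move_down /swap.
by repeat case: ifP => ?; try congr (s _); lia.
Qed.

Lemma move_upS p l s : move_up p l.+1 s = swap (p + l) (move_up p l s).
Proof.
apply/funext => j; rewrite /move_up /swap.
by repeat case: ifP => ?; try congr (s _); lia.
Qed.

Lemma reverseS p l s : reverse p l.+1 s = move_down p l (reverse p l s).
Proof.
apply/funext => j; rewrite /move_down /reverse.
by repeat case: ifP => ?; try congr (s _); lia.
Qed.

Lemma move_down0 p s : move_down p 0 s = s.
Proof.
apply/funext => j; rewrite /move_down.
by repeat case: ifP => ?; try congr (s _); lia.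
Qed.

Lemma move_up0 p s : move_up p 0 s = s.
Proof.
apply/funext => j; rewrite /move_up.
by repeat case: ifP => ?; try congr (s _); lia.
Qed.

Lemma reverse0 p s : reverse p 0 s = s.
Proof.
apply/funext => j; rewrite /reverse.
by repeat case: ifP => ?; try congr (s _); lia.
Qed.

Lemma reverseK p l : involutive (reverse p l).
Proof.
move=> s; apply/funext => j; rewrite /reverse.
by repeat case: ifP => ?; try congr (s _); lia.
Qed.

Lemma move_upK p l : cancel (move_up p l) (move_down p l).
Proof.
move=> s; apply/funext => j; rewrite /move_up /move_down.
by repeat case: ifP => ?; try congr (s _); lia.
Qed.

Lemma swapK i : involutive (swap i).
Proof.
move=> s; apply/funext => j; rewrite /swap.
by repeat case: ifP => ?; try congr (s _); lia.
Qed.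

Lemma rank_move_down p l s q : (q <= p) || (p + l < q) ->
  rank (move_down p l s) q = rank s q.
Proof.
elim: l s => [|l IH] s pq; first by rewrite move_down0.
by rewrite move_downS IH ?rank_swap_other //; lia.
Qed.

Lemma rank_move_up p l s q : (q <= p) || (p + l < q) ->
  rank (move_up p l s) q = rank s q.
Proof.
elim: l => [|l IH] pq; first by rewrite move_up0.
by rewrite move_upS rank_swap_other ?IH //; lia.
Qed.

Lemma rank_reverse p l s q : (q <= p) || (p + l <= q) ->
  rank (reverse p l s) q = rank s q.
Proof.
elim: l => [|l IH] pq; first by rewrite reverse0.
by rewrite reverseS rank_move_down ?IH //; lia.
Qed.

End Markings.

(** H contains a system of elements that satisfies the relations of the sphere
    braid group on M + 1 strands. *)
Section Forgetting.
Variables (H : groupType) (t : nat -> H) (n M : nat).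
Hypothesis far : forall i j, i.+1 < j -> j < M -> commute (t i) (t j).
Hypothesis near :
  forall i, i.+1 < M -> t i * t i.+1 * t i = t i.+1 * t i * t i.+1.
Hypothesis sphere : asc t 0 M * desc t 0 M = 1.

(** The sphere relation of H holds for M + 1 strands; for any other number of
    marked strands, nothing is recorded. *)
Definition labels (s : marking) : nat -> H :=
  if rank s n == M.+1 then t else fun=> 1.

Definition crossing i (s : marking) : H :=
  if s i && s i.+1 then labels s (rank s i) else 1.

Definition cross i (v : marking * H) := (swap i v.1, crossing i v.1 * v.2).
Definition uncross i (v : marking * H) :=
  (swap i v.1, (crossing i (swap i v.1))^-1 * v.2).

Lemma crossK i : cancel (cross i) (uncross i).
Proof. by case=> s g; rewrite /cross /uncross /= swapK mulKg. Qed.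
Lemma uncrossK i : cancel (uncross i) (cross i).
Proof. by case=> s g; rewrite /cross /uncross /= swapK mulVKg. Qed.

Definition crossing_bij i : bijection (marking * H) :=
  Bijection (@crossK i) (@uncrossK i).

Lemma eq_labels s s' : rank s' n = rank s n -> labels s' = labels s.
Proof. by rewrite /labels => ->. Qed.

Lemma labels_swap i s : i.+1 < n -> labels (swap i s) = labels s.
Proof. by move=> i_n; apply: eq_labels; rewrite rank_swap_other //; lia. Qed.

Lemma crossing_swap i j s : (i.+1 < j) || (j.+1 < i) -> j.+1 < n ->
  crossing i (swap j s) = crossing i s.
Proof.
move=> ij jn; rewrite /crossing labels_swap // rank_swap_other; last by lia.
by rewrite !swap_other //; lia.
Qed.

Lemma crossing_far i j : i.+1 < j -> j.+1 < n ->
  commute (crossing_bij i) (crossing_bij j).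
Proof.
move=> ij jn; apply: bijection_ext => -[s g]; rewrite /= /cross /=.
have swapC : swap i (swap j s) = swap j (swap i s).
  apply/funext => k; rewrite /swap.
  by repeat case: ifP => ?; try congr (s _); lia.
rewrite swapC !mulgA !crossing_swap; [|lia..].
congr (_, _ * _); rewrite /crossing.
case: ifP => [/andP[si si1]|_]; rewrite ?mulg1 ?mul1g //.
case: ifP => [/andP[sj sj1]|_]; rewrite ?mulg1 ?mul1g //.
rewrite /labels; case: eqP => [sn|_] //.
have := rank_le s ij; have := rank_le s jn; rewrite !rankS si si1 sj sj1 => ? ?.
by apply: far; lia.
Qed.

(** If all three strands are marked, this is the braid relation in H.  If at
    most two are, both sides record the same crossing, if any. *)
Lemma crossing_near i : i.+2 < n ->
  crossing_bij i * crossing_bij i.+1 * crossing_bij i =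
  crossing_bij i.+1 * crossing_bij i * crossing_bij i.+1.
Proof.
move=> ni; apply: bijection_ext => -[s g]; rewrite /= /cross /=.
have swapC : swap i (swap i.+1 (swap i s)) = swap i.+1 (swap i (swap i.+1 s)).
  apply/funext => k; rewrite /swap.
  by repeat case: ifP => ?; try congr (s _); lia.
rewrite swapC !mulgA; congr (_, _ * _).
have e1 : crossing i.+1 (swap i s) =
    if s i && s i.+2 then labels s (rank s i + s i.+1) else 1.
  rewrite /crossing labels_swap 1?ltnW // rank_swap_mid.
  by rewrite swap_right swap_other //; lia.
have e2 : crossing i (swap i.+1 (swap i s)) =
    if s i.+1 && s i.+2 then labels s (rank s i) else 1.
  rewrite /crossing !labels_swap ?(ltnW ni) // !rank_swap_other; [|lia..].
  by rewrite swap_left swap_other ?swap_left ?swap_other //; lia.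
have e3 : crossing i (swap i.+1 s) =
    if s i && s i.+2 then labels s (rank s i) else 1.
  rewrite /crossing !labels_swap ?(ltnW ni) // !rank_swap_other; [|lia..].
  by rewrite swap_left swap_other //; lia.
have e4 : crossing i.+1 (swap i (swap i.+1 s)) =
    if s i && s i.+1 then labels s (rank s i + s i.+2) else 1.
  rewrite /crossing !labels_swap ?(ltnW ni) // rank_swap_mid.
  rewrite !rank_swap_other; [|lia..].
  rewrite (swap_right i) (@swap_other i _ i.+2); [|lia..].
  by rewrite (swap_left i.+1) (swap_right i.+1) (@swap_other i.+1 _ i) //; lia.
rewrite e1 e2 e3 e4 /crossing rankS.
rewrite /labels; case: eqP => [sn|_]; last by do 3!case: ifP => _.
have := rank_le s ni; rewrite sn !rankS.
case: (s i) (s i.+1) (s i.+2) => -[] [] /= rM;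
  rewrite ?addn0 ?addn1 ?mulg1 ?mul1g //.
by apply: near; lia.
Qed.

(** u carries the marking s to s', and the braid formed by the marked strands is
    h. *)
Definition tracks (u : bijection (marking * H)) s s' (h : H) :=
  forall g, fwd u (s, g) = (s', h * g).

Lemma tracksM u v s s' s'' h k :
  tracks v s s' h -> tracks u s' s'' k -> tracks (u * v) s s'' (k * h).
Proof. by move=> tv tu g; rewrite /= tv tu mulgA. Qed.

Lemma tracks1 s : tracks 1 s s 1. Proof. by move=> g; rewrite mul1g. Qed.

Lemma tracksV u s s' h : tracks u s s' h -> tracks u^-1 s' s h^-1.
Proof.
by move=> tu g; rewrite -[g in LHS](mulVKg h) -tu; apply: fwdK.
Qed.

Lemma tracksX u s h k : tracks u s s h -> tracks (u ^+ k) s s (h ^+ k).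
Proof.
move=> tu; elim: k => [|k IH]; first exact: tracks1.
by rewrite !expgS; apply: tracksM tu.
Qed.

Lemma tracks_crossing i s :
  tracks (crossing_bij i) s (swap i s)
    (if s i && s i.+1 then labels s (rank s i) else 1).
Proof. by move=> g. Qed.

Lemma tracks_asc p l s : p + l < n ->
  tracks (asc crossing_bij p l) s (move_down p l s)
    (if s (p + l)
     then asc (labels s) (rank s p) (rank s (p + l) - rank s p) else 1).
Proof.
elim: l s => [|l IH] s pln.
  rewrite move_down0 asc0 addn0 subnn asc0 if_same; exact: tracks1.
rewrite ascS move_downS.
have plrank := rank_le s (leq_addr l p).
have pl : p + l < n by lia.
have := tracksM (tracks_crossing (p + l) s) (IH (swap (p + l) s) pl).
have pl1 : (p + l).+1 < n by lia.
rewrite swap_left labels_swap // addnS.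
rewrite !rank_swap_other; [|lia..]; rewrite rankS.
case: (s (p + l).+1); last by rewrite andbF mulg1.
rewrite andbT; case: (s (p + l)); last by rewrite addn0 mulg1.
by rewrite addn1 subSn // ascS subnKC.
Qed.

Lemma tracks_desc p l s : p + l < n ->
  tracks (desc crossing_bij p l) s (move_up p l s)
    (if s p
     then desc (labels s) (rank s p) (rank s (p + l).+1 - rank s p.+1) else 1).
Proof.
elim: l => [|l IH] pln.
  rewrite move_up0 desc0 addn0 subnn desc0 if_same; exact: tracks1.
rewrite descS move_upS.
have plrank : rank s p.+1 <= rank s (p + l).+1 by apply: rank_le; lia.
have pl : p + l < n by lia.
have lab : labels (move_up p l s) = labels s.
  by apply/eq_labels/rank_move_up; lia.
have := tracksM (IH pl) (tracks_crossing (p + l) (move_up p l s)); rewrite lab.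
have -> : move_up p l s (p + l) = s p by rewrite /move_up eqxx.
have -> : move_up p l s (p + l).+1 = s (p + l).+1.
  by rewrite /move_up !ifN //; lia.
rewrite addnS (rankS s (p + l).+1).
case sp : (s p); last by rewrite /= mulg1.
have -> : rank (move_up p l s) (p + l) =
    rank s p + (rank s (p + l).+1 - rank s p.+1).
  have : rank (move_up p l s) (p + l).+1 = rank (move_up p l s) (p + l) + 1.
    by rewrite rankS /move_up eqxx sp.
  rewrite rank_move_up ?ltnSn ?orbT //.
  by move: plrank; rewrite (rankS s p) sp; lia.
case: (s (p + l).+1); last by rewrite addn0 mul1g.
by rewrite addn1 subSn // descS.
Qed.

(** The first strand goes around all the others.  If it is marked, it goes
    around all the other marked strands, which is trivial in H. *)
Lemma crossing_sphere :
  0 < n -> asc crossing_bij 0 n.-1 * desc crossing_bij 0 n.-1 = 1.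
Proof.
move=> n0; apply: bijection_ext => -[s g].
have n1 : 0 + n.-1 < n by lia.
have lab : labels (move_up 0 n.-1 s) = labels s.
  by apply/eq_labels/rank_move_up; lia.
have := tracksM (tracks_desc s n1) (tracks_asc (move_up 0 n.-1 s) n1).
rewrite move_upK lab => -> /=.
congr (_, _); rewrite !add0n {1}/move_up add0n eqxx prednK //.
case s0 : (s 0); rewrite ?mul1g // /labels.
case: eqP => [sn|_]; last by rewrite /asc /desc !big1_eq !mul1g.
have rank0 s' : rank s' 0 = 0 by apply: big_ord0.
have last : move_up 0 n.-1 s n.-1 by rewrite /move_up add0n eqxx.
have := rankS (move_up 0 n.-1 s) n.-1.
rewrite prednK // last addn1 rank_move_up ?sn => [[<-]|]; last by lia.
by rewrite rankS !rank0 s0 !subn0 subSS subn0 sphere mul1g.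
Qed.

(** Forgetting strands of a half twist leaves the half twist of the remaining
    ones. *)
Lemma tracks_half_twist p l s : p + l <= n ->
  tracks (half_twist crossing_bij p l) s (reverse p l s)
    (half_twist (labels s) (rank s p) (rank s (p + l) - rank s p)).
Proof.
elim: l => [|l IH] pln.
  rewrite reverse0 addn0 subnn !half_twist0; exact: tracks1.
have plrank := rank_le s (leq_addr l p).
have pl : p + l < n by lia.
rewrite half_twistS reverseS.
have := tracksM (IH (ltnW pl)) (tracks_asc (reverse p l s) pl).
rewrite (@eq_labels s) ?rank_reverse ?leqnn ?orbT //; last by lia.
have -> : reverse p l s (p + l) = s (p + l) by rewrite /reverse ifN //; lia.
rewrite addnS rankS; case: (s (p + l)); last by rewrite addn0 mul1g.
by rewrite addn1 subSn // half_twistS.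
Qed.

End Forgetting.

(** * Actions of the sphere braid group *)
Section Sphere.
Variable n : nat.

(** The generators as a sequence indexed by nat, with the dummy value 1 from
    n - 1 on. *)
Definition sigma (j : nat) : sphere_braid n :=
  if insub j is Some i then gen (@sphere_braid_rel n) i else 1.

Lemma sigma_ord (i : 'I_n.-1) : sigma i = gen (@sphere_braid_rel n) i.
Proof. by rewrite /sigma valK. Qed.

Lemma sigma_far i j : i.+1 < j -> j < n.-1 -> commute (sigma i) (sigma j).
Proof.
move=> ij jn; have i_n : i < n.-1 by lia.
rewrite (sigma_ord (Ordinal i_n)) (sigma_ord (Ordinal jn)).
rewrite /commute -!word_classM.
by apply: word_class_rel; apply: BraidFar; rewrite ij.
Qed.

Lemma sigma_near i : i.+1 < n.-1 ->
  sigma i * sigma i.+1 * sigma i = sigma i.+1 * sigma i * sigma i.+1.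
Proof.
move=> jn; have i_n : i < n.-1 by lia.
rewrite (sigma_ord (Ordinal i_n)) (sigma_ord (Ordinal jn)).
have := word_class_rel (@BraidNear n (Ordinal i_n) (Ordinal jn) erefl).
by rewrite !word_classM.
Qed.

Lemma sigma_sphere : asc sigma 0 n.-1 * desc sigma 0 n.-1 = 1.
Proof.
have := word_class_rel (BraidSphere n); rewrite word_classM word_class1 => <-.
congr (_ * _); rewrite word_class_prod.
  by apply: eq_bigr => i _; rewrite add0n sigma_ord.
by apply: eq_bigr => i _; rewrite add0n; apply: (sigma_ord (rev_ord i)).
Qed.

Section Action.
Variables (H : groupType) (t : nat -> H) (M : nat).
Hypothesis far : forall i j, i.+1 < j -> j < M -> commute (t i) (t j).
Hypothesis near :
  forall i, i.+1 < M -> t i * t i.+1 * t i = t i.+1 * t i * t i.+1.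
Hypothesis sphere : asc t 0 M * desc t 0 M = 1.

Lemma braid_action : 0 < n ->
  exists f : UMagmaMorphism.type (sphere_braid n) (bijection (marking * H)),
    forall j, j < n.-1 -> f (sigma j) = crossing_bij t n M j.
Proof.
move=> n0; pose g (i : 'I_n.-1) := crossing_bij t n M i.
have gR u v : sphere_braid_rel u v -> eval_word g u = eval_word g v.
  case=> [i j ij|i j ij|]; rewrite !eval_wordM ?eval_letter.
  - have := ltn_ord i; have := ltn_ord j; case/orP: ij => ij jn i_n.
      by apply: (@crossing_far _ _ n _ far i j); lia.
    by apply/commute_sym/(@crossing_far _ _ n _ far j i); lia.
  - rewrite /g ij; apply: (@crossing_near _ _ n _ near i).
    by have := ltn_ord j; lia.
  rewrite eval_word1 !eval_word_prod -[RHS](crossing_sphere sphere n0).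
  by congr (_ * _); apply: eq_bigr => i _; rewrite eval_letter.
have [f fE] := presented_hom gR; exists f => j jn.
by rewrite (sigma_ord (Ordinal jn)) fE.
Qed.

End Action.
End Sphere.

Section Morphisms.
Variables (G H : groupType) (f : UMagmaMorphism.type G H).
Variables (s : nat -> G) (s' : nat -> H).

Lemma gmulf_asc p l : (forall j, p <= j < p + l -> f (s j) = s' j) ->
  f (asc s p l) = asc s' p l.
Proof.
elim: l => [|l IH] fs; first by rewrite !asc0 gmulf1.
rewrite !ascS gmulfM IH ?fs // => [|j jl]; first by lia.
by apply: fs; lia.
Qed.

Lemma gmulf_desc p l : (forall j, p <= j < p + l -> f (s j) = s' j) ->
  f (desc s p l) = desc s' p l.
Proof.
elim: l => [|l IH] fs; first by rewrite !desc0 gmulf1.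
rewrite !descS gmulfM IH ?fs // => [|j jl]; first by lia.
by apply: fs; lia.
Qed.

Lemma gmulf_half_twist p l :
  (forall j, p <= j < (p + l).-1 -> f (s j) = s' j) ->
  f (half_twist s p l) = half_twist s' p l.
Proof.
elim: l => [|l IH] fs; first by rewrite !half_twist0 gmulf1.
rewrite !half_twistS gmulfM IH ?gmulf_asc // => j jl; apply: fs; lia.
Qed.

End Morphisms.

Section Tracking.
Variables (n M : nat) (H : groupType) (t : nat -> H).
Hypothesis far : forall i j, i.+1 < j -> j < M -> commute (t i) (t j).
Hypothesis near :
  forall i, i.+1 < M -> t i * t i.+1 * t i = t i.+1 * t i * t i.+1.
Hypothesis sphere : asc t 0 M * desc t 0 M = 1.
Variable f : UMagmaMorphism.type (sphere_braid n) (bijection (marking * H)).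
Hypothesis f_sigma : forall j, j < n.-1 -> f (sigma n j) = crossing_bij t n M j.

Local Notation sigma := (sigma n).
Definition tracked (u : sphere_braid n) := tracks (f u).

Lemma trackedM u v s s' s'' h k :
  tracked v s s' h -> tracked u s' s'' k -> tracked (u * v) s s'' (k * h).
Proof. by rewrite /tracked gmulfM; apply: tracksM. Qed.

Lemma trackedV u s s' h : tracked u s s' h -> tracked u^-1 s' s h^-1.
Proof. by rewrite /tracked gmulfV; apply: tracksV. Qed.

Lemma tracked_eq1 u s h : tracked u s s h -> u = 1 -> h = 1.
Proof.
move=> + u1; rewrite /tracked u1 gmulf1 => /(_ 1) []; by rewrite mulg1.
Qed.

Lemma trackedX u s h k : tracked u s s h -> tracked (u ^+ k) s s (h ^+ k).
Proof. by rewrite /tracked gmulfXn; apply: tracksX. Qed.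

(** The marking s' returns to itself under the commutator of x and z, although x
    moves it. *)
Lemma commutator_infinite x z s s' h k :
  tracked x s s' h -> tracked z s s k -> tracked z s' s' k ->
  (forall m, (h * k * h^-1 * k^-1) ^+ m.+1 <> 1) ->
  forall m, (x * z * x^-1 * z^-1) ^+ m.+1 <> 1.
Proof.
move=> tx tz tz' hk m; apply: contra_not (hk m); apply: tracked_eq1.
apply/trackedX/(trackedM (trackedV tz'))/(trackedM (trackedV tx)).
exact: trackedM tz tx.
Qed.

Lemma tracked_asc p l s : p + l < n -> ~~ s (p + l) ->
  tracked (asc sigma p l) s (move_down p l s) 1.
Proof.
move=> pln /negPf spl; have := tracks_asc t M s pln.
rewrite spl /tracked (gmulf_asc (s' := crossing_bij t n M)) // => j jl.
by apply: f_sigma; lia.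
Qed.

Lemma tracked_desc p l s : p + l < n -> ~~ s p ->
  tracked (desc sigma p l) s (move_up p l s) 1.
Proof.
move=> pln /negPf sp; have := tracks_desc t M s pln.
rewrite sp /tracked (gmulf_desc (s' := crossing_bij t n M)) // => j jl.
by apply: f_sigma; lia.
Qed.

Lemma tracked_half_twist p l r c s s' : rank s n = M.+1 -> p + l <= n ->
  rank s p = r -> rank s (p + l) = r + c -> reverse p l s = s' ->
  tracked (half_twist sigma p l) s s' (half_twist t r c).
Proof.
move=> sn pln sp spl <-; have := tracks_half_twist t M s pln.
rewrite /labels sn eqxx sp spl addKn /tracked.
rewrite (gmulf_half_twist (s' := crossing_bij t n M)) // => j jl.
by apply: f_sigma; lia.
Qed.

End Tracking.

Definition marks (L : seq nat) : marking := fun j => j \in L.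

Lemma rank_marks L p : uniq L -> rank (marks L) p = count (ltn^~ p) L.
Proof.
move=> uL; elim: p => [|p IH].
  by rewrite /rank big_ord0; elim: L {uL} => //= a L <-.
rewrite rankS IH {IH} /marks; elim: L uL => //= a L IH /andP[aL /IH <-].
rewrite in_cons; case: eqVneq aL => [->|pa] aL /=.
  by rewrite (negPf aL); lia.
by lia.
Qed.

Lemma rank_marks_split L L' p : sorted ltn (L ++ L') ->
  all (ltn^~ p) L -> all (leq p) L' -> rank (marks (L ++ L')) p = size L.
Proof.
move=> /(sorted_uniq ltn_trans ltnn) uL Lp pL'.
rewrite rank_marks // count_cat; move: Lp; rewrite all_count => /eqP ->.
rewrite -[RHS]addn0; congr (_ + _); apply/eqP; rewrite -leqn0 leqNgt -has_count.
by apply/hasPn => j /(allP pL'); rewrite leqNgt.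
Qed.

(** Moving the strands acts on markings by precomposition, hence on sets of
    marked positions through the inverse motions. *)
Section MarkedMoves.
Variables p l : nat.

Definition flip_pos j := if p <= j < p + l then p + (p + l).-1 - j else j.
Definition lower_pos j :=
  if j == p then p + l else if p < j <= p + l then j.-1 else j.
Definition raise_pos j :=
  if j == p + l then p else if p <= j < p + l then j.+1 else j.

Lemma flip_posK : involutive flip_pos.
Proof.
move=> j; rewrite [flip_pos j]/flip_pos; case: ifP => ?.
  by rewrite /flip_pos; case: ifP; lia.
by rewrite /flip_pos; case: ifP; lia.
Qed.

Lemma lower_posK : cancel lower_pos raise_pos.
Proof.
move=> j; rewrite [lower_pos j]/lower_pos; do 2?case: ifP => ?;
  by rewrite /raise_pos; do 2?case: ifP => ?; lia.
Qed.

Lemma raise_posK : cancel raise_pos lower_pos.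
Proof.
move=> j; rewrite [raise_pos j]/raise_pos; do 2?case: ifP => ?;
  by rewrite /lower_pos; do 2?case: ifP => ?; lia.
Qed.

Lemma marks_map g g' L : cancel g g' -> cancel g' g ->
  (fun j => marks L (g j)) = marks (map g' L).
Proof.
move=> gK g'K; apply/funext => j.
by rewrite /marks -(mem_map (can_inj g'K)) gK.
Qed.

Lemma reverse_marks L : reverse p l (marks L) = marks (map flip_pos L).
Proof.
rewrite -(marks_map L flip_posK flip_posK); apply/funext => j.
by rewrite /reverse /flip_pos; case: ifP.
Qed.

Lemma move_down_marks L : move_down p l (marks L) = marks (map raise_pos L).
Proof.
rewrite -(marks_map L lower_posK raise_posK); apply/funext => j.
by rewrite /move_down /lower_pos; do 2?case: ifP.
Qed.

Lemma move_up_marks L : move_up p l (marks L) = marks (map lower_pos L).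
Proof.
rewrite -(marks_map L raise_posK lower_posK); apply/funext => j.
by rewrite /move_up /raise_pos; do 2?case: ifP.
Qed.

End MarkedMoves.

(** * Two groups in which the marked strands are evaluated *)
Section Forms.
Import GRing.Theory.
Local Open Scope ring_scope.
Implicit Type v : int * int * int.

(** A triple (a, b, c) stands for the form a X^2 + b X Y + c Y^2.  [formA]
    substitutes X + Y for X, [formB] substitutes Y - X for Y.  The matrix
    -1 acts trivially on forms, which the sphere relation for four strands
    requires. *)
Definition formA v := (v.1.1, 2 * v.1.1 + v.1.2, v.1.1 + v.1.2 + v.2).
Definition formA' v := (v.1.1, v.1.2 - 2 * v.1.1, v.1.1 - v.1.2 + v.2).
Definition formB v := (v.1.1 - v.1.2 + v.2, v.1.2 - 2 * v.2, v.2).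
Definition formB' v := (v.1.1 + v.1.2 + v.2, v.1.2 + 2 * v.2, v.2).

Lemma formAK : cancel formA formA'.
Proof.
by move=> [[a b] c]; rewrite /formA /formA' /=; congr (_, _, _); lia.
Qed.
Lemma formA'K : cancel formA' formA.
Proof.
by move=> [[a b] c]; rewrite /formA /formA' /=; congr (_, _, _); lia.
Qed.
Lemma formBK : cancel formB formB'.
Proof.
by move=> [[a b] c]; rewrite /formB /formB' /=; congr (_, _, _); lia.
Qed.
Lemma formB'K : cancel formB' formB.
Proof.
by move=> [[a b] c]; rewrite /formB /formB' /=; congr (_, _, _); lia.
Qed.

Definition shearA := Bijection formAK formA'K.
Definition shearB := Bijection formBK formB'K.
Definition shear (j : nat) := if j == 1%N then shearB else shearA.

Lemma shear_braid : (shearA * shearB * shearA = shearB * shearA * shearB)%g.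
Proof.
apply: bijection_ext => -[[a b] c]; rewrite /= /formA /formB /=.
by congr (_, _, _); lia.
Qed.

Lemma shear_far i j : (i.+1 < j)%N -> (j < 3)%N -> commute (shear i) (shear j).
Proof. by case: i j => [|[|i]] [|[|[|j]]]. Qed.

Lemma shear_near i : (i.+1 < 3)%N ->
  (shear i * shear i.+1 * shear i = shear i.+1 * shear i * shear i.+1)%g.
Proof. by case: i => [|[|i]] // _; rewrite /shear /= shear_braid. Qed.

Lemma shear_sphere : (asc shear 0 3 * desc shear 0 3 = 1)%g.
Proof.
rewrite !ascS !descS asc0 desc0 mul1g mulg1 /shear /=.
apply: bijection_ext => -[[a b] c]; rewrite /= /formA /formB /=.
by congr (_, _, _); lia.
Qed.

(** The forms with positive outer coefficients and nonpositive middle one are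
    a cone that is stable under [shearB] and under the inverse of [shearA]. *)
Definition growing (u : bijection (int * int * int)) :=
  forall v, 0 < v.1.1 -> v.1.2 <= 0 -> 0 < v.2 ->
  let w := fwd u v in
  [/\ 0 < w.1.1, w.1.2 <= 0, 0 < w.2 & v.1.1 + v.2 < w.1.1 + w.2].

Lemma growing_mul u u' : growing u -> growing u' -> growing (u * u')%g.
Proof.
move=> gu gu' w a b c; case: (gu' w a b c) => a' b' c' lt1.
case: (gu _ a' b' c') => ? ? ? lt2; split=> //.
exact: Order.POrderTheory.lt_trans lt2.
Qed.

Lemma growing_B : growing shearB.
Proof. by move=> [[a b] c] /= ? ? ?; split; lia. Qed.

Lemma growing_AV : growing (shearA^-1)%g.
Proof. by move=> [[a b] c] /= ? ? ?; split; lia. Qed.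

Lemma growing_infinite u m : growing u -> (u ^+ m.+1)%g <> 1%g.
Proof.
move=> gu; have gX : growing (u ^+ m.+1)%g.
  by elim: m => // m IH; rewrite expgS; apply: growing_mul.
by move=> u1; case: (gX (1, 0, 1)) => //; rewrite u1.
Qed.

Definition rot90 (v : int * int) := (- v.2, v.1).
Definition rot90' (v : int * int) := (v.2, - v.1).
Lemma rot90K : cancel rot90 rot90'.
Proof. by move=> [a b]; rewrite /rot90 /rot90' /= opprK. Qed.
Lemma rot90'K : cancel rot90' rot90.
Proof. by move=> [a b]; rewrite /rot90 /rot90' /= opprK. Qed.
Definition rotation90 := Bijection rot90K rot90'K.

Lemma rotation90_4 : (rotation90 ^+ 4 = 1)%g.
Proof. by apply: bijection_ext => -[a b]; rewrite /= /rot90 /= !opprK. Qed.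

Lemma rotation90_6 : (rotation90 ^+ 6 <> 1)%g.
Proof. by move/(congr1 (fun u => fwd u (1, 0))). Qed.

End Forms.

(** The three marked strands cross six times in the full twist. *)
Lemma full_twist_neq1 n : 2 < n -> half_twist (sigma n) 0 n ^+ 2 <> 1.
Proof.
move=> n2.
have far i j : i.+1 < j -> j < 2 -> commute rotation90 rotation90 by [].
have near i : i.+1 < 2 ->
  rotation90 * rotation90 * rotation90 =
  rotation90 * rotation90 * rotation90 by [].
pose t (_ : nat) := rotation90.
have sphere : asc t 0 2 * desc t 0 2 = 1.
  rewrite !ascS !descS asc0 desc0 mul1g mulg1 -rotation90_4.
  by rewrite !expgS mulg1 -!mulgA.
have [f fE] := @braid_action n _ t 2 far near sphere (ltn_trans (ltn0Sn 1) n2).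
pose s := marks [:: 0; 1; 2]%N.
have sn : rank s n = 3 by rewrite rank_marks //=; lia.
have s0 s' : rank s' 0 = 0 by apply: big_ord0.
have tw s' : rank s' n = 3 ->
    tracked f (half_twist (sigma n) 0 n) s' (reverse 0 n s') (half_twist t 0 3).
  by move=> s'n; apply: (tracked_half_twist fE).
have := trackedM (tw s sn) (tw (reverse 0 n s) _).
rewrite rank_reverse ?add0n ?leqnn ?orbT // reverseK => /(_ sn) tr T1.
have := tracked_eq1 tr; rewrite -expg2 => /(_ T1).
rewrite !half_twistS !ascS half_twist0 asc0 !mul1g !mulg1 => q6.
by apply: rotation90_6; rewrite -q6 !expgS !mulg1 -!mulgA.
Qed.

Lemma shear_rotation :
  half_twist shear 0 4 * (half_twist shear 0 3)^-1 = asc shear 0 3.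
Proof. by rewrite half_twistS mulgK. Qed.

(** [asc shear 0 3] is the contribution of a rotation that takes one of the four
    marked strands past the other three. *)
Lemma shear_conj : asc shear 0 3 * shearA = shearB * asc shear 0 3.
Proof.
rewrite !ascS asc0 mul1g /shear /= shear_braid -!mulgA.
by rewrite [shearA * (shearB * shearA)]mulgA shear_braid !mulgA.
Qed.

Lemma shear_infinite1 m :
  (asc shear 0 3 * shearA * (asc shear 0 3)^-1 * shearA^-1) ^+ m.+1 <> 1.
Proof.
rewrite shear_conj mulgK; apply: growing_infinite.
exact: growing_mul growing_B growing_AV.
Qed.

Lemma shear_infinite2 m :
  (asc shear 0 3 * (shearA * shearA) * (asc shear 0 3)^-1 *
    (shearA * shearA)^-1) ^+ m.+1 <> 1.
Proof.
rewrite mulgA shear_conj -(mulgA shearB) shear_conj mulgA mulgK invgM.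
apply: growing_infinite; apply: growing_mul.
  exact: growing_mul growing_B growing_B.
exact: growing_mul growing_AV growing_AV.
Qed.

Ltac rank_split L :=
  match goal with |- rank (marks ?L') ?p = _ =>
    rewrite (@rank_marks_split L (drop (size L) L')) //=; lia
  end.

Ltac eq_marks :=
  rewrite ?reverse_marks ?move_down_marks ?move_up_marks /=;
  match goal with |- marks [:: ?x; ?y; ?z; ?w] = marks ?L =>
    congr (marks [:: _; _; _; _]);
    rewrite /flip_pos /lower_pos /raise_pos; repeat case: ifP => ?; lia
  end.

Section Tracks.
Variable n : nat.
Variable f : UMagmaMorphism.type (sphere_braid n)
  (bijection (marking * bijection (int * int * int))).
Hypothesis f_sigma :
  forall j, j < n.-1 -> f (sigma n j) = crossing_bij shear n 3 j.
Local Notation tracked := (tracked f).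
Local Notation sigma := (sigma n).
Implicit Types a b c d : nat.

Lemma marks_rev x y z w : marks [:: x; y; z; w] = marks [:: w; z; y; x].
Proof. by apply/funext => j; apply: (mem_rev [:: w; z; y; x] j). Qed.

Lemma marks_swap13 x y z w : marks [:: x; y; z; w] = marks [:: z; y; x; w].
Proof.
apply/funext => j; rewrite /marks !inE.
by case: (j == x); case: (j == y); case: (j == z).
Qed.

Lemma marks_swap12 x y L : marks [:: x, y & L] = marks [:: y, x & L].
Proof.
by apply/funext => j; rewrite /marks !inE; case: (j == x); case: (j == y).
Qed.

(** Among the four marked strands, exactly one is in the block of the last k
    strands, which the rotation by k steps takes to the other end. *)
Lemma tracked_rotation p l k a b c d : p + l <= n -> k <= l -> 0 < l ->
  p <= a -> a < b < c -> c < p + l - k <= d -> d < p + l ->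
  tracked (asc sigma p l.-1 ^+ k) (marks [:: a; b; c; d])
    (marks [:: d - (l - k); a + k; b + k; c + k]%N) (asc shear 0 3).
Proof.
move=> pln kl l0 pa abc cd dl.
have pl1 : p + l <= n.-1.+1 by lia.
rewrite (rotationX (@sigma_far n) (@sigma_near n) l0 pl1 kl).
have [d1 d1E] : {d1 | d1 = p + (l - k) + (p + l).-1 - d}%N by eexists.
have [r rE] : {r | r = p + (p + (l - k)).-1}%N by eexists.
pose L1 := [:: a; b; c; d1]; pose L2 := [:: r - c; r - b; r - a; d1]%N.
have t3 : tracked (half_twist sigma (p + (l - k)) k)
    (marks [:: a; b; c; d]) (marks L1) (half_twist shear 3 1).
  apply: (tracked_half_twist f_sigma).
  - rank_split [:: a; b; c; d].
  - lia.
  - rank_split [:: a; b; c].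
  - rank_split [:: a; b; c; d].
  - eq_marks.
have t2 : tracked (half_twist sigma p (l - k)) (marks L2) (marks L1)
    (half_twist shear 0 3).
  apply: (tracked_half_twist f_sigma).
  - rank_split L2.
  - lia.
  - rank_split (Nil nat).
  - rank_split [:: r - c; r - b; r - a]%N.
  - rewrite /L1 marks_swap13; eq_marks.
have t1 : tracked (half_twist sigma p l) (marks L2)
    (marks [:: d - (l - k); a + k; b + k; c + k]%N) (half_twist shear 0 4).
  apply: (tracked_half_twist f_sigma).
  - rank_split L2.
  - lia.
  - rank_split (Nil nat).
  - rank_split L2.
  - rewrite [RHS]marks_rev; eq_marks.
have := trackedM t3 (trackedM (trackedV t2) t1).
by rewrite half_twist1 mulg1 shear_rotation.
Qed.

(** Two marked strands in symmetric positions of a block, the first two ones or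
    the last two ones, are exchanged by the half twist of the block. *)
Lemma tracked_pair_low p l a b c d : a < b < c -> c < d < n -> p <= a ->
  b < p + l <= c -> a + b = (p + (p + l).-1)%N ->
  tracked (half_twist sigma p l) (marks [:: a; b; c; d]) (marks [:: a; b; c; d])
    shearA.
Proof.
move=> abc cd pa bpl ab.
have -> : shearA = half_twist shear 0 2.
  by rewrite !half_twistS half_twist0 asc1 asc0 !mulg1.
apply: (tracked_half_twist f_sigma).
- rank_split [:: a; b; c; d].
- lia.
- rank_split (Nil nat).
- rank_split [:: a; b].
- rewrite [RHS]marks_swap12; eq_marks.
Qed.

Lemma tracked_pair_high p l a b c d : a < b < c -> c < d < p + l ->
  p + l <= n -> b < p <= c -> c + d = (p + (p + l).-1)%N ->
  tracked (half_twist sigma p l) (marks [:: a; b; c; d]) (marks [:: a; b; c; d])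
    shearA.
Proof.
move=> abc cd pln pc cpl.
have -> : shearA = half_twist shear 2 2.
  by rewrite !half_twistS half_twist0 asc1 asc0 !mulg1.
apply: (tracked_half_twist f_sigma).
- rank_split [:: a; b; c; d].
- lia.
- rank_split [:: a; b].
- rank_split [:: a; b; c; d].
- rewrite [RHS]marks_rev [RHS]marks_swap12 [RHS]marks_rev; eq_marks.
Qed.

End Tracks.

(** * Realising the two amalgams *)
Section Realisations.
Variables (n k : nat).
Hypothesis n_gt3 : 3 < n.
Local Notation G := (sphere_braid n).
Local Notation sigma := (sigma n).
Local Notation Delta := (half_twist sigma 0 n).
Let nN : n.-1.+1 = n.
Proof. by lia. Qed.
Let far := @sigma_far n.
Let near := @sigma_near n.
Let sphere := @sigma_sphere n.

Lemma shear_action :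
  exists f : UMagmaMorphism.type G
      (bijection (marking * bijection (int * int * int))),
    forall j, j < n.-1 -> f (sigma j) = crossing_bij shear n 3 j.
Proof. by apply: braid_action shear_far shear_near shear_sphere _; lia. Qed.

(** Two markings with one strand in each of the four arcs are needed: both are
    symmetric under the half twists of the two halves, and the rotation takes
    the first to the second one.  They coincide for k = 1. *)
Lemma K1_from_rotation c (rho : G) : n = (4 * k + 2 * c)%N -> 0 < k ->
  rho ^+ (4 * k) = Delta ^+ 2 -> Delta * rho = rho^-1 * Delta ->
  (forall t, t.+1 < 2 * k ->
    rho ^+ (2 * k) * sigma (c + t) = sigma (c + 2 * k + t) * rho ^+ (2 * k)) ->
  (forall f : UMagmaMorphism.type G
      (bijection (marking * bijection (int * int * int))),
    (forall j, j < n.-1 -> f (sigma j) = crossing_bij shear n 3 j) ->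
    tracked f (rho ^+ k)
      (marks [:: c; c + (2 * k).-1; c + 2 * k; c + (4 * k).-1]%N)
      (marks [:: c + k.-1; c + k; c + (3 * k).-1; c + 3 * k]%N)
      (asc shear 0 3)) ->
  exists (S : pred G) (H : subGroupType S), isomorphic H K1.
Proof.
move=> nE k0 rhoX Drho rho_shift track.
have NE : n.-1.+1 = (4 * k + 2 * c)%N by lia.
have rhoX' : rho ^+ (4 * k) = half_twist sigma 0 n.-1.+1 ^+ 2 by rewrite nN.
have x4 : (rho ^+ k) ^+ 4 = Delta ^+ 2 by rewrite -expgnA mulnC.
have x2 : (rho ^+ k) ^+ 2 = rho ^+ (2 * k) by rewrite -expgnA mulnC.
pose z := half_twist sigma c (2 * k) * half_twist sigma (c + 2 * k) (2 * k).
apply: (@K1_embeds _ (rho ^+ k) Delta z).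
- by rewrite x4.
- by rewrite (intertwineX k Drho) expVgn.
- rewrite x2; exact: (rho_halvesC far near NE rhoX' rho_shift).
- by have := Delta_halvesC far near NE; rewrite nN.
- by rewrite x4; apply: full_twist_neq1; lia.
have [f f_sigma] := shear_action.
apply: commutator_infinite (track f f_sigma) _ _ shear_infinite2.
  apply: trackedM; first by apply: (tracked_pair_high f_sigma); lia.
  by apply: (tracked_pair_low f_sigma); lia.
apply: trackedM; first by apply: (tracked_pair_high f_sigma); lia.
by apply: (tracked_pair_low f_sigma); lia.
Qed.

Lemma K1_in_4k : n = (4 * k)%N ->
  exists (S : pred G) (H : subGroupType S), isomorphic H K1.
Proof.
move=> nE; have k0 : 0 < k by lia.
apply: (@K1_from_rotation 0 (asc sigma 0 n.-1)); rewrite ?addn0 //.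
- by have := alphaXn far near; rewrite nN nE.
- by have := Delta_alpha far near sphere; rewrite nN.
- by move=> t tk; rewrite (asc_shiftX far near) ?add0n ?(addnC t) //; lia.
move=> f f_sigma.
have -> : marks [:: 0 + k.-1; 0 + k; 0 + (3 * k).-1; 0 + 3 * k]%N =
    marks [:: (4 * k).-1 - (n - k); 0 + k; (2 * k).-1 + k; 2 * k + k]%N.
  by congr (marks [:: _; _; _; _]); lia.
by apply: (tracked_rotation f_sigma); lia.
Qed.

Lemma K1_in_4k2 : n = (4 * k + 2)%N ->
  exists (S : pred G) (H : subGroupType S), isomorphic H K1.
Proof.
move=> nE; have k0 : 0 < k by lia.
pose rho := polar_rotation sigma n.-1.
have rhoX : rho ^+ (4 * k) = Delta ^+ 2.
  have -> : (4 * k)%N = n.-1.-1 by lia.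
  by rewrite (polar_rotation_full far near sphere) ?nN //; lia.
apply: (@K1_from_rotation 1 rho) => //.
- have := Delta_polar_rotation far near sphere; rewrite nN; apply; lia.
- move=> t tk; rewrite (polar_rotation_shift far near); [|lia..].
  by congr (sigma _ * _); lia.
move=> f f_sigma; rewrite /rho (polar_rotationX far near); last by lia.
have t1 : tracked f (asc sigma (n.-1 - k) k)
    (marks [:: 1; 1 + (2 * k).-1; 1 + 2 * k; 1 + (4 * k).-1]%N)
    (marks [:: 1; 1 + (2 * k).-1; 1 + 2 * k; 1 + 4 * k]%N) 1.
  have <- : move_down (n.-1 - k) k
      (marks [:: 1; 1 + (2 * k).-1; 1 + 2 * k; 1 + (4 * k).-1]%N) =
    marks [:: 1; 1 + (2 * k).-1; 1 + 2 * k; 1 + 4 * k]%N by eq_marks.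
  by apply: (tracked_asc f_sigma); rewrite /marks ?inE; lia.
have t2 : tracked f (asc sigma 1 n.-1.-1 ^+ k)
    (marks [:: 1; 1 + (2 * k).-1; 1 + 2 * k; 1 + 4 * k]%N)
    (marks [:: 1 + k.-1; 1 + k; 1 + (3 * k).-1; 1 + 3 * k]%N) (asc shear 0 3).
  have -> : marks [:: 1 + k.-1; 1 + k; 1 + (3 * k).-1; 1 + 3 * k]%N =
      marks [:: 1 + 4 * k - (n.-1 - k); 1 + k; 1 + (2 * k).-1 + k;
                1 + 2 * k + k]%N.
    by congr (marks [:: _; _; _; _]); lia.
  by apply: (tracked_rotation f_sigma); lia.
by have := trackedM t1 t2; rewrite mulg1.
Qed.

(** The half twist w of one half of the points becomes the half twist w' of the
    other half under alpha ^+ (2 * k), and [rotationX] factors this half turn as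
    Delta * w^-1 * w'. *)
Lemma K2_in_4k : n = (4 * k)%N ->
  exists (S : pred G) (H : subGroupType S), isomorphic H K2.
Proof.
move=> nE; have k0 : 0 < k by lia.
pose alpha := asc sigma 0 n.-1.
pose w := half_twist sigma 0 (2 * k).
pose w' := half_twist sigma (2 * k) (2 * k).
have NE : n.-1.+1 = (4 * k + 2 * 0)%N by lia.
have alphaXn : alpha ^+ (4 * k) = Delta ^+ 2.
  by rewrite -nE; have := alphaXn far near; rewrite nN.
have ww' : commute w w' := halves_commute far NE.
have Dw : Delta * w = w' * Delta.
  by have := Delta_halves far near NE; rewrite nN.
have iE : alpha ^+ (2 * k) = Delta * w^-1 * w'.
  have pn : 0 + n <= n.-1.+1 by lia.
  have n0 : 0 < n by lia.
  have kn : 2 * k <= n by lia.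
  rewrite (rotationX far near n0 pn kn).
  have -> : (n - 2 * k = 2 * k)%N by lia.
  by rewrite add0n.
have x4 : (alpha ^+ k) ^+ 4 = Delta ^+ 2 by rewrite -expgnA mulnC.
have x2 : (alpha ^+ k) ^+ 2 = alpha ^+ (2 * k) by rewrite -expgnA mulnC.
have Da : Delta * alpha = alpha^-1 * Delta.
  by have := Delta_alpha far near sphere; rewrite nN.
have w'i : w' * alpha ^+ (2 * k) = alpha ^+ (2 * k) * w.
  by rewrite iE !mulgA -Dw mulgK -[RHS]mulgA -ww' mulgA mulgVK.
have cE : w * w'^-1 = alpha ^- (2 * k) * Delta.
  by rewrite iE !invgM invgK !mulgA mulgVK (commuteV ww').
have Di : Delta * alpha ^- (2 * k) = alpha ^+ (2 * k) * Delta.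
  by have := intertwineV (intertwineX (2 * k) Da); rewrite expVgn invgK.
apply: (@K2_embeds _ (alpha ^+ k) w (w * w'^-1)).
- by rewrite x2 -!mulgA -w'i mulKg.
- exact/commute_sym/commuteM/commuteV.
- rewrite cE -mulgA (intertwineX k Da) expVgn !mulgA; congr (_ * _).
  by rewrite -!invgM -!expgnDr addnC.
- by rewrite x4 cE expg2 mulgA -(mulgA _ Delta) Di mulKg.
- by rewrite x4; apply: full_twist_neq1; lia.
have [f f_sigma] := shear_action.
have t1 : tracked f (alpha ^+ k)
    (marks [:: 0; (2 * k).-1; 2 * k; (4 * k).-1]%N)
    (marks [:: k.-1; k; (3 * k).-1; 3 * k]%N) (asc shear 0 3).
  have -> : marks [:: k.-1; k; (3 * k).-1; 3 * k]%N =
    marks [:: (4 * k).-1 - (n - k); 0 + k; (2 * k).-1 + k; 2 * k + k]%N.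
    by congr (marks [:: _; _; _; _]); lia.
  by apply: (tracked_rotation f_sigma); lia.
by apply: commutator_infinite t1 _ _ shear_infinite1;
  apply: (tracked_pair_low f_sigma); lia.
Qed.

(** The marked strands avoid the vertices of the octahedron, which is possible
    only if the blocks contain more than a vertex each, that is if k > 1.  The
    quarter turn of the square does not move the marked strands, so
    [twisted_turn] acts through the half twist of Inner. *)
Lemma K2_in_4k2 : n = (4 * k + 2)%N -> 1 < k ->
  exists (S : pred G) (H : subGroupType S), isomorphic H K2.
Proof.
move=> nE k1.
have [h hE] : {h | h = (2 * k).+1} by eexists.
have h3 : 2 < h by lia.
have NE : n.-1.+1 = (2 * h)%N by lia.
pose x := tilted_rotation sigma n.-1 h ^+ k.
have x2 : x ^+ 2 = tilted_rotation sigma n.-1 h ^+ h.-1.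
  by rewrite -expgnA; congr (_ ^+ _); lia.
have x4 : x ^+ 4 = Delta ^+ 2.
  rewrite (expgnA x 2 2) x2.
  by have := tilted_rotation_full far near sphere h3 NE; rewrite nN.
pose w := twisted_turn sigma h; pose c := square_flip sigma h.
apply: (@K2_embeds _ x w c).
- by rewrite x2; apply: (twisted_turn_tilted far near sphere h3 NE).
- exact: (twisted_turn_flipC far near h3 NE).
- rewrite /x (intertwineX k (square_flip_tilted far near sphere h3 NE)).
  by rewrite expVgn.
- by rewrite x4; have := square_flip2 far near sphere h3 NE; rewrite nN.
- by rewrite x4; apply: full_twist_neq1; lia.
have [f f_sigma] := shear_action.
pose S := marks [:: 2; 2 * k; 2 * k + 3; 4 * k + 1]%N.
pose S' := marks [:: k; k + 2; 3 * k + 1; 3 * k + 3]%N.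
have tx : tracked f x S S' (asc shear 0 3).
  rewrite /x (tilted_rotationX far near h3 NE); last by lia.
  have t1 : tracked f (asc sigma 0 n.-1 ^+ k) S
      (marks [:: k.-1; k + 2; 3 * k; 3 * k + 3]%N) (asc shear 0 3).
    have -> : marks [:: k.-1; k + 2; 3 * k; 3 * k + 3]%N =
        marks [:: 4 * k + 1 - (n - k); 2 + k; 2 * k + k; 2 * k + 3 + k]%N.
      by congr (marks [:: _; _; _; _]); lia.
    by apply: (tracked_rotation f_sigma); lia.
  have t2 : tracked f (asc sigma h k)
      (marks [:: k.-1; k + 2; 3 * k; 3 * k + 3]%N)
      (marks [:: k.-1; k + 2; 3 * k + 1; 3 * k + 3]%N) 1.
    have <- : move_down h k (marks [:: k.-1; k + 2; 3 * k; 3 * k + 3]%N) =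
      marks [:: k.-1; k + 2; 3 * k + 1; 3 * k + 3]%N by eq_marks.
    by apply: (tracked_asc f_sigma); rewrite /marks ?inE; lia.
  have t3 : tracked f (desc sigma 1 k) S'
      (marks [:: k.-1; k + 2; 3 * k + 1; 3 * k + 3]%N) 1.
    have <- : move_up 1 k S' =
      marks [:: k.-1; k + 2; 3 * k + 1; 3 * k + 3]%N by rewrite /S'; eq_marks.
    by apply: (tracked_desc f_sigma); rewrite /S' /marks ?inE; lia.
  have := trackedM t1 (trackedM t2 (trackedV t3)).
  by rewrite invg1 !mul1g.
have tturn a b c' d : 2 <= a -> a < b < h -> h.+1 < c' < d -> d < n ->
    tracked f (square_turn sigma h) (marks [:: a; b; c'; d])
      (marks [:: a; b; c'; d]) 1.
  move=> a2 ab cd dn.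
  have t1 : tracked f (desc sigma 1 h) (marks [:: a; b; c'; d])
      (marks [:: a.-1; b.-1; c'; d]) 1.
    have <- : move_up 1 h (marks [:: a; b; c'; d]) =
      marks [:: a.-1; b.-1; c'; d] by eq_marks.
    by apply: (tracked_desc f_sigma); rewrite /marks ?inE; lia.
  have t2 : tracked f (asc sigma 0 h.-1) (marks [:: a.-1; b.-1; c'; d])
      (marks [:: a; b; c'; d]) 1.
    have <- : move_down 0 h.-1 (marks [:: a.-1; b.-1; c'; d]) =
      marks [:: a; b; c'; d] by eq_marks.
    by apply: (tracked_asc f_sigma); rewrite /marks ?inE; lia.
  by have := trackedM t1 t2; rewrite mulg1.
have tw a b c' d :
    2 <= a -> a < b < h -> h.+1 < c' < d -> d < n -> a + b = h.+1 ->
    tracked f w (marks [:: a; b; c'; d]) (marks [:: a; b; c'; d]) shearA.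
  move=> a2 ab cd dn abh; rewrite -[shearA]mul1g.
  apply: trackedM (tturn _ _ _ _ _ _ _ _) => //.
  by apply: (tracked_pair_low f_sigma); lia.
by apply: commutator_infinite tx _ _ shear_infinite1; apply: tw; lia.
Qed.

End Realisations.

Local Close Scope group_scope.

Theorem proposition78 (n : nat) (n_ge4 : 4 <= n) (n_even : ~~ odd n) :
  (exists (S : pred (sphere_braid n)) (H : subGroupType S), isomorphic H K1)
  /\
  (n = 0 %[mod 4] \/ n = 10 %[mod 12] ->
   exists (S : pred (sphere_braid n)) (H : subGroupType S), isomorphic H K2).
Proof.
split.
  have [n4|n4] : n = (4 * (n %/ 4))%N \/ n = (4 * (n %/ 4) + 2)%N by lia.
    exact: K1_in_4k n_ge4 n4.
  exact: K1_in_4k2 n_ge4 n4.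
case=> [n4|n12].
  by apply: (@K2_in_4k n (n %/ 4)) => //; lia.
by apply: (@K2_in_4k2 n (n %/ 4)) => //; lia.
Qed.
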